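(* Let $(L_1,L_2,\ldots,L_t)$ be the segment decomposition of an even polygonal chain $G$. Then $af(G)=t$.
   Context: All graphs are finite and simple. For a perfect matching $M$ of $G$, a set $S\subseteq E(G)\setminus M$ is an anti-forcing set of $M$ if $M$ is the unique perfect matching of $G-S$; $af(G,M)$ is the minimum cardinality of an anti-forcing set of $M$. $af(G)$ is the minimum of $af(G,M)$ over all perfect matchings $M$ of $G$. A connected plane graph is outerplane if all its vertices lie on the boundary of the exterior face. A face cycle is the boundary of an interior face when it is a cycle; two face cycles are adjacent if they share an edge. An even polygonal chain is a 2-connected plane bipartite graph that is outerplane and in which each face cycle is adjacent to at most two other face cycles. An edge is shared if it is the common edge of two face cycles. A face cycle $s$ of a chain is a kink of that chain if it has two shared edges (of that chain) that can be contained simultaneously in a perfect matching of the cycle $s$. Segment decomposition: label the face cycles of $G$ as $s_1,s_2,\ldots,s_n$ from left to right along the chain ($s_i$ adjacent to $s_{i+1}$). For $i\le j$, $s_i+\cdots+s_j$ denotes the subchain that is the union of these face cycles. The first segment $L_1$ of $G$ is defined as follows. If $G$ has no kink, $L_1=G$. Otherwise let $s_i$ be the first kink of $G$. If $s_i$ is a 4-cycle, $L_1=s_1+\cdots+s_i$. If $s_i$ is not a 4-cycle, then $L_1=s_1+\cdots+s_j$ if $G$ has a second kink $s_j$, and $L_1=G$ if $s_i$ is the only kink of $G$. If $L_1\ne G$, let $G-L_1$ be the subchain consisting of all face cycles of $G$ not in $L_1$; then $L_2$ is the first segment of the even polygonal chain $G-L_1$ (with kinks determined within $G-L_1$), and so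 on until all face cycles are used. The resulting sequence $(L_1,\ldots,L_t)$, $t\geq1$, is the segment decomposition of $G$. *)

(* Defs.v *)
From mathcomp Require Import all_boot.

Set Implicit Arguments.
Unset Strict Implicit.
Unset Printing Implicit Defensive.

Record sgraph := SGraph {
  vertex :> finType;
  adj : rel vertex;
  adj_sym : symmetric adj;
  adj_irr : irreflexive adj
}.

Definition edges (G : sgraph) : {set {set G}} :=
  [set [set d.1; d.2] | d : G * G & adj d.1 d.2].

Definition connected_graph (G : sgraph) : Prop :=
  forall u v : G, connect (@adj G) u v.

Definition two_connected (G : sgraph) : Prop :=
  [/\ 2 < #|G|,
      connected_graph G
    & forall x u v : G, u != x -> v != x ->
        connect [rel a b | [&& adj a b, a != x & b != x]] u v].

Definition bipartite (G : sgraph) : Prop :=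
  exists c : G -> bool, forall u v : G, adj u v -> c u != c v.

(* The argument A is the vertex set and E the edge set of the graph that M     *)
(* matches perfectly.                                                          *)
Definition perfect_matching_of (V : finType) (A : {set V})
    (E M : {set {set V}}) : bool :=
  (M \subset E) && [forall v in A, #|[set e in M | v \in e]| == 1].

Definition perfect_matching (G : sgraph) (M : {set {set G}}) : bool :=
  perfect_matching_of [set: G] (edges G) M.

Definition anti_forcing_set (G : sgraph) (M S : {set {set G}}) : bool :=
  (S \subset edges G :\: M) &&
  ([set N | perfect_matching_of [set: G] (edges G :\: S) N] == [set M]).

(* When M is a perfect matching, edges G :\: M is an anti-forcing set of M, so *)
(* that the minimum below ranges over a nonempty family.                       *)
Definition af_matching (G : sgraph) (M : {set {set G}}) : nat :=
  #|[arg min_(S < edges G :\: M | anti_forcing_set M S) #|S|]|.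

(* The value is 0 by convention if G has no perfect matching. *)
Definition af (G : sgraph) : nat :=
  if [pick M : {set {set G}} | perfect_matching M] is Some M0 then
    af_matching [arg min_(M < M0 | perfect_matching M) af_matching M]
  else 0.

Definition face_step (G : sgraph) (rot : G -> G -> G) (d : G * G) : G * G :=
  (d.2, rot d.2 d.1).

(* The orbit of the dart d (an oriented edge) under face tracing. *)
Definition face_of (G : sgraph) (rot : G -> G -> G) (d : G * G)
    : {set G * G} :=
  [set d' | fconnect (face_step rot) d d'].

Definition faces_of (G : sgraph) (rot : G -> G -> G) : {set {set G * G}} :=
  [set face_of rot d | d : G * G & adj d.1 d.2].

(* Connected plane graphs with at least one edge, up to homeomorphism of the   *)
(* plane, given as combinatorial maps: rot v is the cyclic order of the        *)
(* neighbours of v around v, Euler's formula says that the resulting surface   *)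
(* is the sphere, and the exterior face is the one traced from outer_dart.     *)
Record plane_graph := PlaneGraph {
  pgraph :> sgraph;
  pg_connected : connected_graph pgraph;
  rot : pgraph -> pgraph -> pgraph;
  rot_adj : forall v u, adj v u -> adj v (rot v u);
  rot_cyclic : forall v u w, adj v u -> adj v w -> fconnect (rot v) u w;
  euler_formula : #|pgraph| + #|faces_of rot| = #|edges pgraph| + 2;
  outer_dart : pgraph * pgraph;
  outer_dart_adj : adj outer_dart.1 outer_dart.2
}.

Definition faces (G : plane_graph) : {set {set G * G}} := faces_of (@rot G).

Definition exterior_face (G : plane_graph) : {set G * G} :=
  face_of (@rot G) (outer_dart G).

Definition boundary (G : plane_graph) (f : {set G * G}) : {set {set G}} :=
  [set [set d.1; d.2] | d in f].

Definition outerplane (G : plane_graph) : Prop :=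
  forall v : G, v \in cover (boundary (exterior_face G)).

(* A cycle is identified with its edge set; its vertex set is cover C. *)
Definition is_cycle (V : finType) (C : {set {set V}}) : bool :=
  [exists n : 'I_#|V|.+1, exists p : n.-tuple V,
    [&& 2 < n, uniq p & C == [set [set x; next p x] | x in p]]].

Definition face_cycles (G : plane_graph) : {set {set {set G}}} :=
  [set C | is_cycle C & C \in [set boundary f | f in faces G :\ exterior_face G]].

Definition adjacent_cycles (V : finType) (C1 C2 : {set {set V}}) : bool :=
  (C1 != C2) && (C1 :&: C2 != set0).

Definition even_polygonal_chain (G : plane_graph) : Prop :=
  [/\ two_connected G, bipartite G, outerplane G
    & forall C, C \in face_cycles G ->
        #|[set C' in face_cycles G | adjacent_cycles C C']| <= 2].

(* s lists the face cycles of G from one end of the chain to the other. *)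
Definition chain_labelling (G : plane_graph) (s : seq {set {set G}}) : Prop :=
  [/\ uniq s, s =i face_cycles G & sorted (@adjacent_cycles G) s].

(* From here on the subchain s_i + ... + s_j is represented by the sequence of *)
(* its face cycles s_i, ..., s_j.                                              *)
Definition shared_edge (V : finType) (c : seq {set {set V}}) (e : {set V})
    : bool :=
  has (fun C1 => has (fun C2 => (C1 != C2) && (e \in C1 :&: C2)) c) c.

Definition kink (V : finType) (c : seq {set {set V}}) (C : {set {set V}})
    : bool :=
  [exists e1 in C, exists e2 in C,
    [&& e1 != e2, shared_edge c e1, shared_edge c e2
      & [exists M, [&& perfect_matching_of (cover C) C M, e1 \in M
                     & e2 \in M]]]].

(* The number of face cycles of the first segment of c; i and j are the        *)
(* (0-based) positions in c of the first and second kinks of c.                *)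
Definition first_segment_size (V : finType) (c : seq {set {set V}}) : nat :=
  let i := find (kink c) c in
  if size c <= i then size c
  else if #|nth set0 c i| == 4 then i.+1
  else
    let j := i.+1 + find (kink c) (drop i.+1 c) in
    if size c <= j then size c else j.+1.

Definition first_segment (V : finType) (c : seq {set {set V}}) :=
  take (first_segment_size c) c.

(* The fuel n only serves termination: the first segment of a nonempty chain   *)
(* is nonempty, so size c steps use up c.                                      *)
Fixpoint segments_rec (V : finType) (n : nat) (c : seq {set {set V}})
    : seq (seq {set {set V}}) :=
  if n is n'.+1 then
    if c is [::] then [::]
    else first_segment c :: segments_rec n' (drop (first_segment_size c) c)
  else [::].

Definition segment_decomposition (V : finType) (c : seq {set {set V}}) :=
  segments_rec (size c) c.

(* Main.v *)
Require Import Defs.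
From mathcomp Require Import all_boot.
From mathcomp Require Import all_algebra zify.

Set Implicit Arguments.
Unset Strict Implicit.
Unset Printing Implicit Defensive.

(** The idea of the proof.

    Fix a proper 2-colouring of the vertices and give each dart (oriented edge) the
    colour of its tail. Every dart lies on one face, and colours alternate along a
    face, so the two colours in a face cycle are its two perfect matchings. Number
    the interior faces 0, ..., n-1 along the chain. A perfect matching is coded by a
    word w of n bits: an edge belongs to it if and only if, for each interior face i
    that contains the edge, its dart in face i has colour w i. Let k i be the colour
    in face i of the edge shared by faces i and i+1; in face i+1 this edge has the
    opposite colour. The words that occur are those with w i = k i or w (i+1) <> k i
    for all i, and a face i with two neighbours is a kink exactly if k (i-1) <> k i.
    In this way perfect matchings become the order ideals of a zigzag, turning at the
    kinks.

    That every perfect matching N has such a word ([perfect_matching_of_facewise])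
    rests on a discrete Jordan curve theorem, [even_set_is_boundary]: by Euler's
    formula, every edge set with even degrees is a sum modulo 2 of face boundaries.
    It is applied to the sum of N and one of the two perfect matchings contained in
    the exterior Hamiltonian cycle. The same theorem and 2-connectedness show that no
    face visits a vertex twice ([face_tail_inj]), so faces are cycles. Since the
    exterior face is Hamiltonian, Euler's formula leaves n-1 edges for the interior;
    hence consecutive faces of the chain share one edge and other faces share none
    ([shared_dart]).

    An anti-forcing set of M meets every other perfect matching. For the lower bound,
    [lower_bound] produces for every M as many other matchings as there are segments,
    no two of which have a common edge outside M. For the upper bound, [upper_bound]
    forbids one edge for each segment, which forces the letters of that segment.
    What distinguishes 4-cycles is that a kink that is a 4-cycle has no edge of the
    colour of its two shared edges other than these two, so this colour cannot be
    excluded there ([free_dart], [free_available]). *)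

(** * Words over a zigzag *)

(** Boolean hypotheses about letters make [lia] branch exponentially, hence the
    restriction to order facts between natural numbers. *)
Ltac nat_lia := repeat match goal with
  | H : ?T |- _ => lazymatch T with
    | is_true (leq _ _) => fail
    | is_true (leq _ _ && leq _ _) => fail
    | @eq ?A _ _ => tryif unify A nat then fail else clear H
    | is_true (~~ (@eq_op ?A _ _)) =>
        tryif unify (Equality.sort A) nat then fail else clear H
    | _ => clear H
    end
  end; lia.

(** A word w assigns a bit to each of the faces 0, ..., n-1. The bit [k i] is the
    colour, in face i, of the edge that faces i and i.+1 share; its colour in face
    i.+1 is the opposite one. Read along a stretch where k is constant, the
    condition [valid] says that the letters equal to k come first, so the valid
    words are the order ideals of a zigzag whose extremal elements are the faces at
    which k changes; [square] tells which faces are 4-cycles. *)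
Section Fence.

Variables (n : nat) (k square : nat -> bool).

Definition valid a (w : nat -> bool) : Prop :=
  forall i, a <= i -> i.+1 < n -> (w i == k i) || (w i.+1 != k i).

Definition turn i := k i.-1 != k i.

(** The condition under which an edge belongs to the matching coded by a word:
    [Free i b] for an edge of colour b of face i that no other interior face
    contains, [Shared i] for the common edge of faces i and i.+1. *)
Inductive event := Free of nat & bool | Shared of nat.

Definition holds (w : nat -> bool) ev :=
  match ev with
  | Free i b => w i == b
  | Shared i => (w i == k i) && (w i.+1 != k i)
  end.

(** Which free edges exist. At a kink both shared edges have the colour [k i]; in a
    4-cycle there are only two edges of that colour, hence none is free. *)
Definition available i b :=
  ~~ [&& 0 < i, i.+1 < n, turn i, square i & b == k i].

(** The edges of the part of the chain that starts at face a. In that part, face a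
    has at most one shared edge and so free edges of both colours; in the whole
    chain one of those may be the edge shared with face a.-1, and this is what
    makes an induction along the chain possible. *)
Definition usable a ev :=
  match ev with
  | Free i b => [&& a <= i, i < n & (i == a) || available i b]
  | Shared i => (a <= i) && (i.+1 < n)
  end.

(** The possible shapes of the first segment of the part of the chain that starts
    at face a; the index is the face after the segment. *)
Inductive first_run a : nat -> Prop :=
| NoTurn : a < n -> (forall x, a < x -> x.+1 < n -> ~~ turn x) -> first_run a n
| OneTurn i : a < i -> i.+1 < n -> turn i -> ~~ square i ->
    (forall x, a < x -> x.+1 < n -> x != i -> ~~ turn x) -> first_run a n
| SquareTurn b : a < b -> b.+1 < n -> turn b -> square b ->
    (forall x, a < x < b -> ~~ turn x) -> first_run a b.+1
| TwoTurns i b : a < i < b -> b.+1 < n -> turn i -> turn b -> ~~ square i ->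
    (forall x, a < x < b -> x != i -> ~~ turn x) -> first_run a b.+1.

Inductive runs : nat -> nat -> Prop :=
| RunsNil : runs n 0
| RunsCons a b t : first_run a b -> runs b t -> runs a t.+1.

(** The matchings coded by u and v share no edge outside the one coded by w. An
    anti-forcing set of the latter therefore meets u and v in different edges. *)
Definition compatible a w u v : Prop :=
  forall ev, usable a ev -> ~~ holds w ev -> ~~ (holds u ev && holds v ev).

Definition has_alternatives a t : Prop :=
  forall w, valid a w -> exists W : nat -> nat -> bool,
    (forall p, p < t -> valid a (W p) /\ exists2 i, a <= i < n & W p i != w i) /\
    (forall p q, p < q < t -> compatible a w (W p) (W q)).

Lemma constant_run a b x : (forall y, a < y < b -> ~~ turn y) ->
  a <= x < b -> k x = k a.
Proof.
move=> noturn; elim: x => [|x IHx] /andP[ax xb]; first by congr k; nat_lia.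
have [->//|neq] := eqVneq a x.+1.
rewrite -IHx; last nat_lia.
by have := noturn x.+1; rewrite /turn /= negbK => /(_ _)/eqP-> //; nat_lia.
Qed.

(** Validity propagates a letter different from k to the right. *)
Lemma run_forward a c w lo hi x y : valid a w -> a <= lo -> hi < n ->
  (forall z, lo <= z < hi -> k z = c) -> lo <= x -> x <= y -> y <= hi ->
  w x != c -> w y != c.
Proof.
move=> vw alo hin kc lox + + wx; elim: y => [|y IHy] xy yhi.
  by have <- : x = 0 by nat_lia.
have [<-//|neq] := eqVneq x y.+1.
have wy : w y != c by apply: IHy; nat_lia.
have := vw y; rewrite kc; last nat_lia.
rewrite (negPf wy) /=; apply; nat_lia.
Qed.

Definition flip q (w : nat -> bool) x := if x == q then ~~ w x else w x.

(** In a stretch whose letters are c, ..., c, then not c, either the last c may be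
    changed or, if there is none, the first letter. *)
Lemma flippable a i c w : valid a w -> a < i < n ->
  (forall z, a <= z < i -> k z = c) -> w i != c ->
  exists2 q, a <= q < i & valid a (flip q w).
Proof.
move=> vw /andP[ai ilt] kc wi.
have [wa|wa] := eqVneq (w a) c; last first.
  exists a; first by nat_lia.
  move=> x ax xn; rewrite /flip; have [-> | xa] := eqVneq x a.
    rewrite kc; last nat_lia.
    by move: wa; case: (w a); case: (c).
  by rewrite ifF; [apply: vw | nat_lia].
have [q aqi [wq wq1]] : exists2 q, a <= q < i & w q = c /\ w q.+1 != c.
  have [m Em] : exists m, i = a + m by exists (i - a); nat_lia.
  move: ai ilt wi {kc}; rewrite Em => _ _; elim: m {Em} => [|m IHm].
    by rewrite addn0 wa eqxx.
  rewrite addnS => wi; have [wm|wm] := eqVneq (w (a + m)) c.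
    by exists (a + m); [nat_lia | ].
  by have [q ? ?] := IHm wm; exists q; [nat_lia | ].
exists q; first by nat_lia.
move=> x ax xn; rewrite /flip; have [->|xq] := eqVneq x q.
  rewrite ifF; last lia.
  by rewrite kc ?wq1 ?orbT //; lia.
have [xq1|_] := eqVneq x.+1 q; last exact: vw.
rewrite xq1 wq kc; last nat_lia.
by case: (c); rewrite orbT.
Qed.

Lemma alternatives_none : has_alternatives n 0.
Proof. by move=> w _; exists (fun=> w); split=> // p q; nat_lia. Qed.

(** A constant word is valid whatever k is. *)
Lemma alternatives_last a : a < n -> has_alternatives a 1.
Proof.
move=> an w vw; exists (fun _ _ => ~~ w a); split=> [p _|p q]; last by nat_lia.
split=> [i _ _|]; first by case: (w a); case: (k i).
by exists a; [nat_lia | case: (w a)].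
Qed.

(** Extends an alternative u of the tail starting at b.+1 to the left of it. If
    [w b = k b], the constraint between b and b.+1 holds with any tail and w can be
    kept; otherwise the letter of b copies that of b.+1, because equal letters are
    always allowed. *)
Definition lift b (w u : nat -> bool) x :=
  if x < b then w x
  else if x == b then if w b == k b then w b else u b.+1
  else u x.

Lemma lift_lt b w u x : x < b -> lift b w u x = w x.
Proof. by rewrite /lift => ->. Qed.

Lemma lift_gt b w u x : b < x -> lift b w u x = u x.
Proof. by rewrite /lift => bx; rewrite ltnNge ltnW // gtn_eqF. Qed.

Lemma lift_eq b w u : lift b w u b = if w b == k b then w b else u b.+1.
Proof. by rewrite /lift ltnn eqxx. Qed.

(** Lifted tail alternatives remain compatible: the edges around face b are new only
    in a lift whose tail changes the letter of b.+1, and there is at most one such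
    tail. Hence a segment adds one alternative as soon as some w0 is compatible
    with every lift. *)
Lemma alternatives_cons a b t (w w0 : nat -> bool) :
  a < b -> b.+1 < n -> turn b -> has_alternatives b.+1 t ->
  valid a w ->
  valid a w0 -> (exists2 i, a <= i < n & w0 i != w i) ->
  (forall u ev, usable a ev -> ~~ holds w ev -> holds w0 ev ->
    valid b.+1 u -> ~~ holds (lift b w u) ev) ->
  exists W : nat -> nat -> bool,
    (forall p, p < t.+1 -> valid a (W p) /\ exists2 i, a <= i < n & W p i != w i) /\
    (forall p q, p < q < t.+1 -> compatible a w (W p) (W q)).
Proof.
move=> ab bn tb altb vw vw0 w0w comp0.
have [|W' [altW' compW']] := altb w; first by move=> i ? ?; apply: vw; nat_lia.
have vb : (w b == k b) || (w b.-1 == k b.-1).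
  have := vw b.-1; have -> : b.-1.+1 = b by nat_lia.
  move=> /(_ _ _); move: tb; rewrite /turn => tb /(_ ltac:(nat_lia) ltac:(nat_lia)).
  by move: tb; case: (k _); case: (k _); case: (w _); case: (w _).
have vlift u : valid b.+1 u -> valid a (lift b w u).
  move=> vu x ax xn; case: (ltngtP x b) => [xb|bx|->].
  - rewrite lift_lt //; case: (ltngtP x.+1 b) => [x1b|x1b|x1b]; last rewrite x1b.
    + by rewrite lift_lt //; exact: vw.
    + nat_lia.
    + rewrite lift_eq; case: ifP => wb; first by rewrite -x1b; exact: vw.
      by move: vb; rewrite wb /= -x1b /= => /eqP ->; rewrite eqxx.
  - by rewrite !lift_gt; [apply: vu | nat_lia | nat_lia].
  - rewrite lift_eq lift_gt //.
    by case: ifP => [->//|_]; case: (u _); case: (k _).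
exists (fun p => if p is p'.+1 then lift b w (W' p') else w0); split.
  case=> [|p] pt; first by split.
  have [vp [i ib wi]] := altW' p pt; split; first exact: vlift.
  by exists i; [nat_lia | rewrite lift_gt //; nat_lia].
move=> [|p] [|q] pq //.
  move=> ev uev wev; have [vq _] := altW' q ltac:(nat_lia).
  by case h0: (holds w0 ev); rewrite //= (comp0 _ _ uev wev h0 vq).
have comp := compW' p q pq => ev uev wev.
(* Both colours are usable at the first letter of the tail, so at most one of the
   two tail alternatives changes the letter of face b.+1. *)
have differ : (W' p b.+1 == w b.+1) || (W' q b.+1 == w b.+1).
  have := comp (Free b.+1 (~~ w b.+1)); rewrite /usable /holds leqnn bn eqxx /=.
  by move=> /(_ isT); case: (w _); case: (W' p _); case: (W' q _) => // /(_ isT).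
have wb1 : (w b == k b) || (w b.+1 != k b).
  by apply: vw => //; exact: ltnW.
case: ev uev wev => [i c|i] /=.
  case/and3P => ai iltn av wi.
  case: (ltngtP i b) => [ib|bi|ib].
  - by rewrite !lift_lt // andbb.
  - rewrite !lift_gt //; apply: (comp (Free i c)) => //=; rewrite bi iltn /=.
    case/orP: av => [/eqP ia|->]; last by rewrite orbT.
    by have := ltn_trans ab bi; rewrite ia ltnn.
  - move: wi; rewrite ib !lift_eq; case: ifP => [_ wi|]; first by rewrite andbb.
    move: wb1 differ.
    move: (w b) (k b) (c) (w b.+1) (W' p _) (W' q _).
    by clear; do 6!case.
case/andP=> ai i1n wi.
case: (ltngtP i b) => [ib|bi|ib].
- rewrite !(lift_lt _ _ ib); case: (ltngtP i.+1 b) => [x1b|x1b|x1b].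
  + by rewrite !lift_lt // andbb.
  + by have := leq_trans x1b ib; rewrite ltnn.
  + move: wi vb wb1 differ; rewrite x1b !lift_eq -x1b /=.
    move: (w i) (w i.+1) (w i.+2) (k i) (k i.+1) (W' p _) (W' q _).
    by clear; do 7!case.
- rewrite !lift_gt ?(leqW bi) //.
  by apply: (comp (Shared i)) => //=; rewrite bi.
- move: wi; rewrite ib !lift_eq !lift_gt //.
  move: differ; move: (w b) (w b.+1) (k b) (W' p _) (W' q _).
  by clear; do 5!case.
Qed.

(** A flip far enough to the left of b only concerns edges at which the lifts agree
    with w. *)
Lemma holds_flip b q (w u : nat -> bool) ev :
  (q.+1 < b) || (q < b) && (w b == k b) ->
  ~~ holds w ev -> holds (flip q w) ev -> ~~ holds (lift b w u) ev.
Proof.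
move=> qb nw.
have same x : x <= q.+1 -> lift b w u x = w x.
  case: (ltngtP x b) => [xb _|bx xq|-> bq]; first by rewrite lift_lt.
    by case/orP: qb => [|/andP[]]; nat_lia.
  by rewrite lift_eq; case/orP: qb => [qb|/andP[_ ->] //]; rewrite ltnNge bq in qb.
case: ev nw => [i c|i] /=; rewrite /flip.
  by have [->|_ /negPf->] := eqVneq i q; first by rewrite same.
have [->|iq] := eqVneq i q; first by rewrite !same // ?leqnSn.
have [iq1|_ /negPf->] := eqVneq i.+1 q; last by [].
by rewrite !same //; nat_lia.
Qed.

Lemma runs_end t : runs n t -> t = 0.
Proof.
move En : {1}n => m r; case: r En => // a b {}t [] *; nat_lia.
Qed.

Lemma turnE a b : (forall y, a < y < b -> ~~ turn y) -> a < b -> turn b ->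
  k b = ~~ k a.
Proof.
move=> noturn ab; rewrite /turn (constant_run (x := b.-1) noturn); last nat_lia.
by case: (k a); case: (k b).
Qed.

(** One alternative for each segment. For the last one a constant word will do. In
    the others a single flip within the segment is compatible with the lifts, except when the segment ends with a 4-cycle b, has no other
    kink, and all its letters are [k a]. Then the lifts may change the letter of b,
    but their only new edges at b are the one shared with b.-1 and free edges of
    the colour [k b], which do not exist in a 4-cycle; so w0, which changes all
    letters of the segment, may use the edge shared with b.+1. *)
Lemma lower_bound a t : runs a t -> has_alternatives a t.
Proof.
elim=> [|{}a b {}t]; first exact: alternatives_none.
case=> {b}[an _|i ai i1n _ _ _|b ab b1n tb fb noturn|
           i b /andP[ai ib] b1n ti tb _ noturn] r IH.
- by rewrite (runs_end r); exact: alternatives_last.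
- by rewrite (runs_end r); apply: alternatives_last; nat_lia.
- move=> w vw; have kb : k b = ~~ k a by exact: turnE.
  have kc z : a <= z < b -> k z = k a by exact: constant_run.
  have [wb|wb] := eqVneq (w b) (k b).
    have [||q aqb vq] := flippable (i := b) vw _ kc; first nat_lia.
      by rewrite wb kb; case: (k a).
    apply: (alternatives_cons ab b1n tb IH vw vq).
      by exists q; [nat_lia | rewrite /flip eqxx; case: (w q)].
    move=> u ev _ nw hq _; apply: holds_flip nw hq.
    by rewrite wb eqxx andbT; case/andP: aqb => _ ->; rewrite orbT.
  have wka x : a <= x <= b -> w x = k a.
    move=> axb; apply/eqP/negPn/negP => wx.
    have : w b != k a.
      by apply: (run_forward (lo := a) (hi := b) vw _ _ kc _ _ _ wx); nat_lia.
    by move: wb; rewrite kb; case: (w b); case: (k a).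
  have bk : b <= b by [].
  apply: (alternatives_cons (w0 := fun x => if x <= b then ~~ k a else w x)
    ab b1n tb IH vw).
  + move=> x ax xn; case: (ltngtP x b) => [xb|bx|->].
    * by rewrite kc ?ax //; case: (k a).
    * exact: vw.
    * by rewrite kb eqxx.
  + exists a; first nat_lia.
    by rewrite (ltnW ab) wka ?leqnn ?(ltnW ab) //; case: (k a).
  + move=> u [i c|i] uev nw h0 _; last first.
      move: h0 nw => /=; case: (ltngtP i b) => [ib|bi|->].
      * by move: uev => /= /andP[ai _]; rewrite kc ?ai //; case: (k a).
      * by move=> ->.
      * rewrite lift_eq lift_gt // (negPf wb) => _ _.
        by case: (u _); case: (k _).
    move: h0 nw uev => /=; case: (ltngtP i b) => [ib|bi|->].
    * by rewrite lift_lt.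
    * by move=> ->.
    * rewrite /available fb tb b1n (gtn_eqF ab) (leq_ltn_trans _ ab) //=.
      by move=> /eqP <- _; rewrite kb eqxx !andbF.
- move=> w vw.
  have noturn1 y : a < y < i -> ~~ turn y by move=> ?; apply: noturn; nat_lia.
  have noturn2 y : i < y < b -> ~~ turn y by move=> ?; apply: noturn; nat_lia.
  have ki : k i = ~~ k a by exact: turnE.
  have kb : k b = ~~ k i by exact: turnE.
  have ka z : a <= z < i -> k z = k a by exact: constant_run.
  have kc z : i <= z < b -> k z = k i by exact: constant_run.
  have [q /and3P[aq qb qb1] vq] : exists2 q,
      [&& a <= q, q < b & (q.+1 < b) || (w b == k b)] & valid a (flip q w).
    have [wi|wi] := eqVneq (w i) (k a); last first.
      have [|q aqb vq] := flippable (i := i) vw _ ka wi; first nat_lia.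
      by exists q => //; apply/and3P; split; try apply/orP; try left; lia.
    have wb : w b = k b.
      rewrite kb; apply/eqP; have : w b != k i; last by case: (w b); case: (k i).
      apply: (run_forward (lo := i) (hi := b) (x := i) vw _ _ kc); try nat_lia.
      by rewrite wi ki; case: (k a).
    exists i; first by rewrite wb eqxx orbT ib (ltnW ai).
    move=> x ax xn; rewrite /flip; have [->|xi] := eqVneq x i.
      by rewrite wi ki eqxx.
    have [xi1|_] := eqVneq x.+1 i; last exact: vw.
    by rewrite xi1 wi ka ?ax -?xi1 ?leqnn //; case: (k a); rewrite orbT.
  have ab := ltn_trans ai ib.
  apply: (alternatives_cons ab b1n tb IH vw vq).
    by exists q; [nat_lia | rewrite /flip eqxx; case: (w q)].
  move=> u ev _ nw hq _; apply: holds_flip nw hq.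
  by case/orP: qb1 => ->; rewrite ?qb ?orbT.
Qed.

(** Forbidding t edges leaves a single valid word. *)
Definition forced_by a t : Prop :=
  exists m (S : seq event),
  [/\ size S = t, valid a m,
      all (fun ev => usable a ev && ~~ holds m ev) S
    & forall w, valid a w -> all (fun ev => ~~ holds w ev) S ->
        forall i, a <= i < n -> w i = m i].

Lemma forced_last a ev c :
  usable a ev -> ~~ holds (fun=> c) ev ->
  (forall w, valid a w -> ~~ holds w ev -> forall i, a <= i < n -> w i = c) ->
  forced_by a 1.
Proof.
move=> uev cev force; exists (fun=> c), [:: ev]; split=> //=.
- by move=> i _ _; case: (c); case: (k i).
- by rewrite uev cev.
- by move=> w vw /andP[nw _]; exact: force.
Qed.

(** When all letters up to b are forced to be [k b], the constraint between b and
    b.+1 is void, and the tail can be forced independently. A free edge that the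
    tail has but the whole chain lacks is the edge shared by b and b.+1: as
    [w b = k b], it is in the matching exactly if the letter of b.+1 is not [k b]. *)
Lemma forced_cons a b t ev :
  a <= b -> b.+1 < n -> forced_by b.+1 t -> usable a ev ->
  (forall m, (forall i, a <= i <= b -> m i = k b) -> ~~ holds m ev) ->
  (forall w, valid a w -> ~~ holds w ev -> forall i, a <= i <= b -> w i = k b) ->
  forced_by a t.+1.
Proof.
move=> ab bn [m' [S [Ssize vm' usS force]]] uev cev forcec.
pose m x := if x <= b then k b else m' x.
have mb x : x <= b -> m x = k b by rewrite /m => ->.
have mb1 x : b < x -> m x = m' x by rewrite /m ltnNge => /negPf->.
pose tr e := if e is Free i d then
  if (i == b.+1) && ~~ available i d then Shared b else e else e.
have trP w e : w b = k b -> usable b.+1 e -> holds w (tr e) = holds w e.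
  case: e => //= i d wb; case: ifP => // /andP[/eqP->]; rewrite negbK.
  case/and5P=> _ _ tb _ /eqP-> _ /=; rewrite wb eqxx.
  by move: tb; rewrite /turn /=; case: (w _); case: (k b); case: (k b.+1).
have holds_m e : usable b.+1 e -> holds m e = holds m' e.
  by case: e => [i d|i] /=; [case/and3P=> bi _ _|case/andP=> bi _];
    rewrite !mb1 // (leqW bi).
exists m, (ev :: map tr S); split.
- by rewrite /= size_map Ssize.
- move=> x ax xn; case: (ltngtP x b) => [xb|bx|->].
  + by rewrite !mb //; [case: (k b); case: (k x) | exact: ltnW].
  + by rewrite !mb1 ?(leqW bx) //; exact: vm'.
  + by rewrite mb ?eqxx.
- rewrite /= uev cev /=; last by move=> i /andP[_]; exact: mb.
  rewrite all_map; apply: sub_all usS => e /andP[ue nm] /=.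
  rewrite trP ?mb // holds_m // nm andbT.
  case: e ue {nm} => [i d|i] /= /andP[bi]; last by rewrite (leq_trans ab (ltnW bi)).
  case/andP=> iltn; case: eqP => [->|_] /=.
    by case: ifP => /=; [rewrite ab | move/negbFE->; rewrite (leqW ab) bn orbT].
  by move->; rewrite (leq_trans ab (ltnW bi)) iltn orbT.
- move=> w vw /= /andP[nev nS] i /andP[ai iltn].
  have wb := forcec w vw nev.
  have [ib|bi] := leqP i b; first by rewrite mb // wb // ai.
  rewrite mb1 //; apply: force; last by rewrite bi.
    by move=> x bx xn; apply: vw => //; exact: leq_trans ab (ltnW bx).
  move: usS nS; elim: (S) => //= e S' IH /andP[/andP[ue _] /IH{}IH].
  by rewrite trP ?wb ?ab ?leqnn // => /andP[-> /IH->].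
Qed.

(** One forbidden edge for each segment. If there is a kink i that is not a 4-cycle,
    excluding the colour [k i] at i forces the opposite letter to the left of i and,
    after the change of direction, to the right of i. Otherwise excluding the colour
    [k a] at the first face forces the letters to the right. *)
Lemma upper_bound a t : a < n -> runs a t -> forced_by a t.
Proof.
move=> + r; elim: r => [|{}a b {}t]; first by rewrite ltnn.
case=> {b}[an noturn|i ai i1n ti nfi noturn|b ab b1n tb fb noturn|
           i b /andP[ai ib] b1n ti tb nfi noturn] r IH _.
- rewrite (runs_end r); apply: (forced_last (ev := Free a (k a)) (c := ~~ k a)).
  + by rewrite /= leqnn an eqxx.
  + by rewrite /=; case: (k a).
  move=> w vw nw i /andP[ai iltn].
  have kc z : a <= z < n.-1 -> k z = k a.
    by apply: constant_run => y ayn; apply: noturn; nat_lia.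
  have : w i != k a by apply: (run_forward (lo := a) (hi := n.-1) vw _ _ kc) nw; nat_lia.
  by case: (w i); case: (k a).
- rewrite (runs_end r).
  have noturn1 y : a < y < i -> ~~ turn y by move=> ?; apply: noturn; nat_lia.
  have noturn2 y : i < y < n.-1 -> ~~ turn y by move=> ?; apply: noturn; nat_lia.
  have ki : k i = ~~ k a by exact: turnE.
  have ka z : a <= z < i -> k z = k a by exact: constant_run.
  have kc z : i <= z < n.-1 -> k z = k i by exact: constant_run.
  apply: (forced_last (ev := Free i (k i)) (c := ~~ k i)).
  + by rewrite /= /available (negPf nfi) !andbF /= (ltnW ai) (ltnW i1n) orbT.
  + by rewrite /=; case: (k i).
  move=> w vw /= nw x /andP[ax xn].
  have [xi|ix] := leqP x i.
    rewrite ki negbK; apply/eqP/negPn/negP => wx.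
    have : w i != k a by apply: (run_forward (lo := a) (hi := i) vw _ _ ka) wx; nat_lia.
    by move: nw; rewrite ki; case: (w i); case: (k a).
  have : w x != k i by apply: (run_forward (lo := i) (hi := n.-1) vw _ _ kc) nw; nat_lia.
  by case: (w x); case: (k i).
- have kb : k b = ~~ k a by exact: turnE.
  have kc z : a <= z < b -> k z = k a by exact: constant_run.
  apply: (forced_cons (ev := Free a (k a)) (ltnW ab) b1n (IH b1n)).
  + by rewrite /= leqnn eqxx /=; nat_lia.
  + by move=> m mb /=; rewrite mb ?leqnn ?(ltnW ab) // kb; case: (k a).
  move=> w vw nw x axb.
  have : w x != k a by apply: (run_forward (lo := a) (hi := b) vw _ _ kc) nw; nat_lia.
  by rewrite kb; case: (w x); case: (k a).
- have noturn1 y : a < y < i -> ~~ turn y by move=> ?; apply: noturn; nat_lia.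
  have noturn2 y : i < y < b -> ~~ turn y by move=> ?; apply: noturn; nat_lia.
  have ki : k i = ~~ k a by exact: turnE.
  have kb : k b = ~~ k i by exact: turnE.
  have ka z : a <= z < i -> k z = k a by exact: constant_run.
  have kc z : i <= z < b -> k z = k i by exact: constant_run.
  apply: (forced_cons (ev := Free i (k i)) (ltnW (ltn_trans ai ib)) b1n (IH b1n)).
  + rewrite /= /available (negPf nfi) !andbF /= (ltnW ai) orbT andbT.
    exact: ltn_trans (ltnW b1n).
  + move=> m mb /=; rewrite mb ?(ltnW ai) ?(ltnW ib) // kb; by case: (k i).
  move=> w vw /= nw x /andP[ax xb].
  have [xi|ix] := leqP x i.
    rewrite kb ki negbK; apply/eqP/negPn/negP => wx.
    have : w i != k a by apply: (run_forward (lo := a) (hi := i) vw _ _ ka) wx; nat_lia.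
    by move: nw; rewrite ki; case: (w i); case: (k a).
  have : w x != k i by apply: (run_forward (lo := i) (hi := b) vw _ _ kc) nw; nat_lia.
  by rewrite kb; case: (w x); case: (k i).
Qed.

End Fence.

(** * Exactness over the field with two elements *)

Section LinearAlgebra.
Import GRing.Theory.
Local Open Scope ring_scope.

(** For the incidence matrices below, connectedness says that the kernel consists of
    the constant vectors. *)
Lemma rank_const_ker (K : fieldType) m n (A : 'M[K]_(m, n)) :
  (forall x : 'rV_m, x *m A = 0 -> exists c, x = const_mx c) ->
  (m <= (\rank A).+1)%N.
Proof.
move=> constA; have : (kermx A <= (const_mx 1 : 'rV[K]_m))%MS.
  apply/rV_subP => x /sub_kermxP/constA[c ->]; apply/sub_rVP; exists c.
  by apply/rowP => j; rewrite !mxE mulr1.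
move=> /mxrankS; rewrite mxrank_ker => /leq_trans/(_ (rank_leq_row _)).
by rewrite leq_subLR addn1.
Qed.

(** Both ranks are then at least one less than the number of rows, resp. columns,
    and Euler's formula leaves no room for homology. *)
Lemma exact_of_euler (K : fieldType) m n p (B : 'M[K]_(m, n)) (A : 'M[K]_(n, p)) :
  B *m A = 0 -> (p + m = n + 2)%N ->
  (forall x : 'rV_m, x *m B = 0 -> exists c, x = const_mx c) ->
  (forall x : 'rV_p, x *m A^T = 0 -> exists c, x = const_mx c) ->
  (kermx A <= B)%MS.
Proof.
move=> BA0 euler /rank_const_ker rB /rank_const_ker; rewrite mxrank_tr => rA.
have sBA : (B <= kermx A)%MS by rewrite sub_kermx BA0.
rewrite -(mxrank_leqif_sup sBA) eqn_leq mxrankS //= mxrank_ker.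
by have := rank_leq_row A; lia.
Qed.

Lemma F2_bool (x : 'F_2) : x = (x != 0)%:R.
Proof. by apply/eqP; case: x => [[|[|]]]. Qed.

Lemma addb_F2 (a b : bool) : ((a (+) b)%:R : 'F_2) = a%:R + b%:R.
Proof. by case: a; case: b => //; apply/eqP. Qed.

Lemma bool_F2_inj : injective (fun b : bool => b%:R : 'F_2).
Proof. by case; case. Qed.
End LinearAlgebra.

(** * Darts and edges *)

Definition rev_dart (T : Type) (d : T * T) := (d.2, d.1).
Definition edge_of (T : finType) (d : T * T) : {set T} := [set d.1; d.2].

Section Graph.
Variable G : sgraph.
Definition is_dart (d : G * G) := adj d.1 d.2.
Local Notation rev := (@rev_dart G).
Local Notation edge := (@edge_of G).

Lemma rev_dartK : involutive rev. Proof. by case. Qed.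

Lemma edge_rev d : edge (rev d) = edge d.
Proof. exact: setUC. Qed.

Lemma dart_rev d : is_dart (rev d) = is_dart d.
Proof. by rewrite /is_dart adj_sym. Qed.

Lemma dart_neq d : is_dart d -> d.1 != d.2.
Proof. by apply: contraTneq => e; rewrite /is_dart e adj_irr. Qed.

Lemma edge_eq d d' : is_dart d -> is_dart d' ->
  edge d = edge d' -> d' = d \/ d' = rev d.
Proof.
case: d d' => [a b] [a' b'] /dart_neq /= ab /dart_neq /= ab' /setP e.
have := e a'; have := e b'; rewrite !inE !eqxx orbT /=.
move=> /orP[] /eqP eb /orP[] /eqP ea; subst; rewrite ?eqxx // in ab ab' *;
  by [left | right].
Qed.

Lemma mem_edges e : reflect (exists2 d, is_dart d & e = edge d) (e \in edges G).
Proof.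
apply: (iffP imsetP) => [[d]|[d dd ->]].
  by rewrite inE => dd ->; exists d.
by exists d; rewrite ?inE.
Qed.

Lemma edge_in d : is_dart d -> edge d \in edges G.
Proof. by move=> dd; apply/mem_edges; exists d. Qed.

Lemma edge_tail_inj v : {in [set d | is_dart d && (d.1 == v)] &, injective edge}.
Proof.
move=> d d'; rewrite !inE => /andP[dd /eqP dv] /andP[dd' /eqP dv'] e.
case: (edge_eq dd dd' e) => // d'E; have := dart_neq dd.
by rewrite dv -dv' d'E eqxx.
Qed.

Lemma star_edges v : [set e in edges G | v \in e] =
  edge @: [set d | is_dart d && (d.1 == v)].
Proof.
apply/setP => e; apply/idP/imsetP => [|[d]]; rewrite inE.
  case/andP=> /mem_edges[d dd ->]; rewrite !inE => /orP[]/eqP->.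
    by exists d; rewrite // inE dd eqxx.
  by exists (rev d); rewrite ?edge_rev // inE dart_rev dd eqxx.
by case/andP=> dd /eqP <- ->; rewrite inE edge_in // !inE eqxx.
Qed.

(** Sums over the edges at v can be computed over the darts that leave v. *)
Lemma sum_star (R : Type) (idx : R) (op : Monoid.com_law idx) v (F : {set G} -> R) :
  \big[op/idx]_(e in edges G | v \in e) F e =
  \big[op/idx]_(d | is_dart d && (d.1 == v)) F (edge d).
Proof.
transitivity (\big[op/idx]_(e in [set e in edges G | v \in e]) F e).
  by apply: eq_bigl => e; rewrite inE.
rewrite star_edges big_imset /=; last exact: edge_tail_inj.
by apply: eq_bigl => d; rewrite inE.
Qed.

End Graph.

(** * Faces of a combinatorial map *)

Section PlaneMap.
Variable G : plane_graph.
Local Notation D := (G * G)%type.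
Local Notation rev := (@rev_dart G).
Local Notation edge := (@edge_of G).
Local Notation phi := (face_step (@Defs.rot G)).
Local Notation face := (face_of (@Defs.rot G)).

Lemma rot_inj (v : G) : {in [pred u | adj v u] &, injective (@Defs.rot G v)}.
Proof.
pose N := [set u | adj v u].
have sub : N \subset @Defs.rot G v @: N.
  apply/subsetP => u; rewrite inE => vu.
  have /iter_findex <- := rot_cyclic (rot_adj vu) vu.
  set j := findex _ _ _; rewrite -iterSr iterS; apply: imset_f; rewrite inE.
  by elim: (j) => //= i; exact: rot_adj.
have /imset_injP inj : #|@Defs.rot G v @: N| == #|N|.
  by rewrite eqn_leq leq_imset_card subset_leq_card.
by move=> u w vu vw; apply: inj; rewrite inE.
Qed.

Lemma dart_step d : is_dart d -> is_dart (phi d).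
Proof. by rewrite /is_dart /= adj_sym; exact: rot_adj. Qed.

Lemma step_inj : {in @is_dart G &, injective phi}.
Proof.
move=> [a b] [a' b'] dd dd' [bb]; subst b' => /rot_inj e.
by rewrite e // inE adj_sym; [exact: dd | exact: dd'].
Qed.

Lemma face_id d : d \in face d.
Proof. by rewrite inE connect0. Qed.

Lemma face_dart d d' : is_dart d -> d' \in face d -> is_dart d'.
Proof.
move=> dd; rewrite inE => /iter_findex <-; elim: (findex _ _ _) => //= i.
exact: dart_step.
Qed.

Lemma face_eq d d' : is_dart d -> d' \in face d -> face d' = face d.
Proof.
move=> dd d'd; have dd' := face_dart dd d'd; apply/setP => d''.
rewrite inE in d'd; have dd1 : fconnect phi d' d.
  by rewrite (fconnect_sym_in (S := @is_dart G)) //; [exact: dart_step | exact: step_inj].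
rewrite !inE; apply/idP/idP; exact: connect_trans.
Qed.

Lemma face_step_eq d : is_dart d -> face (phi d) = face d.
Proof. by move=> dd; apply: face_eq; rewrite // inE fconnect1. Qed.

Lemma mem_face d d' : is_dart d -> is_dart d' -> (d' \in face d) = (face d' == face d).
Proof.
move=> dd dd'; apply/idP/eqP; first exact: face_eq.
by move=> <-; exact: face_id.
Qed.

Lemma face_in d : is_dart d -> face d \in faces G.
Proof. by move=> dd; apply/imsetP; exists d; rewrite ?inE. Qed.

Lemma facesP f : reflect (exists2 d, is_dart d & f = face d) (f \in faces G).
Proof.
apply: (iffP imsetP) => [[d]|[d dd ->]]; first by rewrite inE; exists d.
by exists d; rewrite ?inE.
Qed.

Lemma iter_step_invariant (T : Type) (P : D -> T) d i :
  (forall d, is_dart d -> P (phi d) = P d) -> is_dart d -> P (iter i phi d) = P d.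
Proof.
move=> Pphi dd; suff [] : is_dart (iter i phi d) /\ P (iter i phi d) = P d by [].
by elim: i => //= i [di Pi]; rewrite dart_step // Pphi.
Qed.

Lemma face_invariant (T : Type) (P : D -> T) d d' :
  (forall d, is_dart d -> P (phi d) = P d) -> is_dart d -> d' \in face d -> P d' = P d.
Proof.
move=> Pphi dd; rewrite inE => /iter_findex <-; exact: iter_step_invariant.
Qed.

Lemma step_face d : is_dart d -> phi @: face d = face d.
Proof.
move=> dd; apply/eqP; rewrite eqEcard card_in_imset ?leqnn ?andbT.
  apply/subsetP => _ /imsetP[a ad ->]; have da := face_dart dd ad.
  by rewrite mem_face ?dart_step // face_step_eq // -mem_face.
by move=> a b /(face_dart dd) + /(face_dart dd); exact: step_inj.
Qed.

(** One turn of the rotation at v is a reversal followed by a face step. *)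
Lemma rotate_invariant (Q : D -> Prop) (v u w : G) :
  (forall d, is_dart d -> d.1 = v -> Q d -> Q (phi (rev d))) ->
  adj v u -> adj v w -> Q (v, u) -> Q (v, w).
Proof.
move=> Qrot vu vw Qu; have /iter_findex <- := rot_cyclic vu vw.
suff [] : adj v (iter (findex (Defs.rot v) u w) (Defs.rot v) u) /\
  Q (v, iter (findex (Defs.rot v) u w) (Defs.rot v) u) by [].
elim: (findex _ _ _) => //= i [vi Qi]; split; first exact: rot_adj.
exact: (Qrot (v, _)).
Qed.

Lemma map_connected (T : Type) (P : D -> T) :
  (forall d, is_dart d -> P (phi d) = P d) ->
  (forall d, is_dart d -> P (rev d) = P d) ->
  forall d d', is_dart d -> is_dart d' -> P d = P d'.
Proof.
move=> Pphi Prev [u a] [v b].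
have star (x y z : G) : adj x y -> adj x z -> P (x, y) = P (x, z).
  move=> xy xz; apply: (rotate_invariant (Q := fun d => P (x, y) = P d) _ xy xz) => //.
  by move=> d dd _ ->; rewrite Pphi ?Prev // dart_rev.
have [p] := connectP (pg_connected u v); elim: p u a => /= [|w p IHp] u a.
  by move=> _ ->; exact: star.
case/andP=> uw wp vp ua vb; rewrite (star u a w) // -(Prev (u, w)) //.
by apply: IHp => //; rewrite /is_dart adj_sym.
Qed.

Lemma darts_of_edge (d : D) (F : D -> 'F_2) : is_dart d ->
  (\sum_(d' | is_dart d' && (edge d' == edge d)) F d' = F d + F (rev d))%R.
Proof.
move=> dd; rewrite (bigD1 d) ?dd ?eqxx //= (bigD1 (rev d)) /=; last first.
  rewrite dart_rev dd edge_rev eqxx /=; apply: contraTneq dd.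
  by case: (d) => a b [-> _]; rewrite /is_dart adj_irr.
rewrite big1 ?GRing.addr0 // => d' /andP[/andP[/andP[dd' /eqP e] n1] n2].
by case: (edge_eq dd dd' (esym e)) n1 n2 => ->; rewrite eqxx.
Qed.

Section Exactness.
Import GRing.Theory.
Local Open Scope ring_scope.

(** A discrete Jordan curve theorem: an edge set x with even degrees is a sum of
    face boundaries modulo 2. The function y selects the faces of the sum, and an
    edge is in x when y selects exactly one of its two sides. The incidence matrices
    face-edge and edge-vertex compose to zero, and the kernels of the first and of
    the transpose of the second are the constants by connectedness. *)
Lemma even_set_is_boundary (x : D -> bool) :
  (forall d, is_dart d -> x (rev d) = x d) ->
  (forall v, \big[addb/false]_(d | is_dart d && (d.1 == v)) x d = false) ->
  exists y : D -> bool, (forall d, is_dart d -> y (phi d) = y d) /\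
    (forall d, is_dart d -> x d = y d (+) y (rev d)).
Proof.
move=> xrev xeven.
pose A : 'M['F_2]_(#|edges G|, #|G|) :=
  \matrix_(i, j) ((enum_val j \in (enum_val i : {set G}))%:R).
pose B : 'M['F_2]_(#|faces G|, #|edges G|) :=
  \matrix_(i, j) (\sum_(d in (enum_val i : {set D})) (edge d == enum_val j)%:R).
pose o := outer_dart G; have od : is_dart o := outer_dart_adj G.
pose fi d := enum_rank_in (face_in od) (face d).
have fiK d : is_dart d -> enum_val (fi d) = face d.
  by move=> dd; rewrite enum_rankK_in // face_in.
have fi_phi d : is_dart d -> fi (phi d) = fi d.
  by move=> dd; rewrite /fi face_step_eq.
have fiE i d : is_dart d -> (d \in (enum_val i : {set D})) = (fi d == i).
  move=> dd; apply/idP/eqP => [|<-]; last by rewrite fiK ?face_id.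
  have /facesP[d' dd' e] := enum_valP i; rewrite e => d'd.
  by rewrite -[RHS](enum_valK_in (face_in od)) e /fi (face_eq dd' d'd).
have valP (i : 'I_#|faces G|) d : d \in (enum_val i : {set D}) -> is_dart d.
  have /facesP[d' dd' ->] := enum_valP i; exact: face_dart.
pose e_i d := enum_rank_in (edge_in od) (edge d).
have eiK d : is_dart d -> enum_val (e_i d) = edge d.
  by move=> dd; rewrite enum_rankK_in // edge_in.
have yB (y : 'rV_#|faces G|) d : is_dart d ->
    (y *m B) 0 (e_i d) = y 0 (fi d) + y 0 (fi (rev d)).
  move=> dd; rewrite -(darts_of_edge (fun d => y 0 (fi d)) dd) mxE.
  rewrite [RHS](partition_big fi xpredT) //=.
  apply: eq_bigr => i _; rewrite mxE eiK // big_distrr /=.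
  rewrite big_mkcond [RHS]big_mkcond; apply: eq_bigr => d' _.
  case dd': (is_dart d'); last first.
    by case: ifP => // /valP; rewrite dd'.
  rewrite (fiE _ _ dd'); case: eqP => [->|_]; rewrite ?andbF //=.
  by case: eqP; rewrite ?mulr1 ?mulr0.
(* A face enters each vertex as often as it leaves it. *)
have BA0 : B *m A = 0.
  apply/matrixP => i j; rewrite !mxE.
  under eq_bigr => l _ do rewrite !mxE big_distrl /=.
  rewrite exchange_big /=.
  have incid d : is_dart d -> \sum_(l < #|edges G|)
      (edge d == enum_val l)%:R * (enum_val j \in (enum_val l : {set G}))%:R
      = (d.1 == enum_val j)%:R + (d.2 == enum_val j)%:R :> 'F_2.
    move=> dd; rewrite (bigD1 (e_i d)) //= eiK // eqxx mul1r big1 => [|l nl].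
      rewrite addr0 !inE ![enum_val j == _]eq_sym.
      have dn := dart_neq dd; case: (d.1 =P _) => [<-|_] /=; last by rewrite add0r.
      by rewrite eq_sym (negPf dn) addr0.
    rewrite (_ : (_ == _) = false) ?mul0r //; apply: contraNF nl => /eqP e.
    by rewrite -[l](enum_valK_in (edge_in od)) -e.
  under eq_bigr => d di do rewrite incid ?(valP _ _ di) //.
  rewrite big_split /=.
  have /facesP[d0 dd0 ->] := enum_valP i.
  rewrite -{1}(step_face dd0) big_imset /=; last first.
    by move=> d d' /(face_dart dd0) + /(face_dart dd0); exact: step_inj.
  by rewrite -big_split big1 //= => d _; case: eqP => // _; apply/eqP.
have yconst (y : 'rV_#|faces G|) : y *m B = 0 -> exists c, y = const_mx c.
  move=> y0; exists (y 0 (fi o)); apply/rowP => i; rewrite mxE.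
  have /facesP[d dd e] := enum_valP i.
  have -> : i = fi d by rewrite -[LHS](enum_valK_in (face_in od)) e.
  apply: (map_connected (P := fun d => y 0 (fi d))) => // d' dd'.
    by rewrite fi_phi.
  have := yB y d' dd'; rewrite y0 mxE.
  by move: (y 0 _) (y 0 _); do 2![case=> [[|[|//]] ?]] => // _; apply: val_inj.
have vconst (z : 'rV_#|G|) : z *m A^T = 0 -> exists c, z = const_mx c.
  move=> z0; exists (z 0 (enum_rank o.1)); apply/rowP => i; rewrite mxE.
  have zE d : is_dart d -> z 0 (enum_rank d.1) = z 0 (enum_rank d.2).
    move=> dd; have /matrixP/(_ 0 (e_i d)) := z0; rewrite !mxE.
    rewrite (bigD1 (enum_rank d.1)) // (bigD1 (enum_rank d.2)) /=; last first.
      by rewrite (inj_eq enum_rank_inj) eq_sym dart_neq.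
    rewrite !mxE eiK // !enum_rankK !inE !eqxx orbT !mulr1 big1 ?addr0 => [|l].
      by move: (z 0 _) (z 0 _); do 2![case=> [[|[|//]] ?]] => // _; apply: val_inj.
    case/andP=> l1 l2; rewrite !mxE eiK // !inE.
    rewrite -[l]enum_valK !(inj_eq enum_rank_inj) in l1 l2.
    by rewrite (negPf l1) (negPf l2) mulr0.
  rewrite -[i]enum_valK; have /connectP[p] := pg_connected o.1 (enum_val i).
  elim: p (o.1) => [u _ -> //|w p IHp u] /= /andP[uw wp] e.
  by rewrite (IHp w wp e) (zE (u, w)).
have exact := exact_of_euler BA0 _ yconst vconst.
have {}exact := exact (euler_formula G).
pose xx : 'rV['F_2]_#|edges G| :=
  \row_j ([exists d, [&& is_dart d, x d & edge d == enum_val j]]%:R).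
have xxE d : is_dart d -> xx 0 (e_i d) = (x d)%:R.
  move=> dd; rewrite mxE eiK //; congr (_%:R : 'F_2); congr nat_of_bool.
  apply/existsP/idP => [[d' /and3P[dd' xd' /eqP e]]|xd]; last first.
    by exists d; rewrite dd xd eqxx.
  by case: (edge_eq dd dd' (esym e)) xd' => ->; rewrite ?xrev.
have : (xx <= kermx A)%MS.
  apply/sub_kermxP/rowP => j; rewrite !mxE.
  transitivity (\sum_(e in edges G)
      xx 0 (enum_rank_in (edge_in od) e) * (enum_val j \in e)%:R).
    rewrite [RHS]big_enum_val; apply: eq_bigr => l _.
    by rewrite enum_valK_in !mxE.
  transitivity (\sum_(e in edges G | enum_val j \in e) xx 0 (enum_rank_in (edge_in od) e)).
    rewrite [RHS]big_mkcondr; apply: eq_bigr => e _; case: ifP; by rewrite ?mulr1 ?mulr0.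
  rewrite sum_star.
  transitivity (\sum_(d | is_dart d && (d.1 == enum_val j)) ((x d)%:R : 'F_2)).
    by apply: eq_bigr => d /andP[dd _]; rewrite -xxE.
  rewrite -(big_morph (fun b : bool => b%:R : 'F_2) (id2 := false) (op2 := addb)
    addb_F2) //.
  by rewrite xeven.
case/(submx_trans)/(_ exact)/submxP => y xxy.
exists (fun d => y 0 (fi d) != 0); split=> [d dd|d dd]; first by rewrite fi_phi.
apply: bool_F2_inj; rewrite addb_F2 -!F2_bool -yB // -xxE //.
by rewrite xxy.
Qed.

End Exactness.
End PlaneMap.

(** * Faces of 2-connected maps *)

Lemma addb_telescope (g : nat -> bool) k :
  \big[addb/false]_(i < k) (g i (+) g i.+1) = g 0 (+) g k.
Proof.
elim: k => [|k IH]; first by rewrite big_ord0 addbb.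
by rewrite big_ord_recr /= IH addbA -(addbA (g 0)) addbb addbF.
Qed.

Lemma big_traject (R T : Type) (idx : R) (op : R -> R -> R) f (x : T) k (F : T -> R) :
  \big[op/idx]_(y <- traject f x k) F y = \big[op/idx]_(i < k) F (iter i f x).
Proof.
elim: k x => [|k IH] x; first by rewrite big_nil big_ord0.
rewrite big_cons IH big_ord_recl /=; congr (op _ _).
by apply: eq_bigr => i _; rewrite -iterSr.
Qed.

Section TwoConnected.
Variable G : plane_graph.
Hypothesis G_2conn : two_connected G.
Local Notation D := (G * G)%type.
Local Notation rev := (@rev_dart G).
Local Notation edge := (@edge_of G).
Local Notation phi := (face_step (@Defs.rot G)).
Local Notation face := (face_of (@Defs.rot G)).

(** In a 2-connected plane graph no face passes twice through a vertex v. Otherwise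
    its walk W from the first passage to the second is a closed walk, and by
    [even_set_is_boundary] it separates the selected faces from the others. Let B
    consist of the darts on selected faces and those of W. It is closed under
    reversal, and under the face steps at vertices other than v; so B contains all or none of the
    darts at a vertex other than v. But it contains d1, and not the dart d2 of the
    second passage: removing v disconnects the graph. *)
Lemma face_tail_inj d1 d2 :
  is_dart d1 -> d2 \in face d1 -> d2.1 = d1.1 -> d2 = d1.
Proof.
move=> dd1 d2d1 tail; apply/eqP/negPn/negP => neq.
have conn : fconnect phi d1 d2 by rewrite inE in d2d1.
pose k := findex phi d1 d2; pose W := traject phi d1 k.
have kE : iter k phi d1 = d2 by exact: iter_findex.
have k_lt : k < order phi d1 by exact: findex_max.
have Wuniq : uniq W.
  rewrite /W -(take_traject phi d1 (ltnW k_lt)) take_uniq //; exact: orbit_uniq.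
have WP d : reflect (exists2 i, i < k & d = iter i phi d1) (d \in W).
  exact: trajectP.
have Wface d : d \in W -> d \in face d1.
  by case/WP=> i _ ->; rewrite inE fconnect_iter.
have Wdart d : d \in W -> is_dart d by move/Wface; exact: face_dart.
have d2W : d2 \notin W.
  apply/negP => /WP[i ik e]; have := findex_iter (ltn_trans ik k_lt).
  by rewrite -e -/k => ki; rewrite ki ltnn in ik.
have d1W : d1 \in W.
  apply/WP; exists 0 => //; rewrite lt0n; apply: contraNneq neq => k0.
  by rewrite -kE k0.
pose x d := (d \in W) (+) (rev d \in W).
have [|v|y [yphi yx]] := @even_set_is_boundary G x.
- by move=> d _; rewrite /x rev_dartK addbC.
- rewrite big_split /= [X in _ (+) X](reindex_inj (can_inj (@rev_dartK G))) /=.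
  have sumW (h : D -> G) : \big[addb/false]_(d | is_dart d && (h d == v)) (d \in W)
      = \big[addb/false]_(i < k) (h (iter i phi d1) == v).
    transitivity (\big[addb/false]_(d <- W) (h d == v)); last first.
      exact: (big_traject _ _ _ _ _ (fun d => h d == v)).
    rewrite big_uniq //= big_mkcond [RHS]big_mkcond; apply: eq_bigr => d _.
    by case dW: (d \in W); rewrite ?(Wdart _ dW) /=; case: ifP.
  under [X in _ (+) X]eq_bigl => d do rewrite dart_rev.
  under [X in _ (+) X]eq_bigr => d _ do rewrite rev_dartK.
  rewrite (sumW fst) (sumW snd) -big_split /=.
  rewrite (addb_telescope (fun i => (iter i phi d1).1 == v)) /= kE tail.
  exact: addbb.
(* The selection is normalised so that it does not contain the face of d1. *)
pose B d := (y d (+) y d1) || (d \in W).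
have yface d : d \in face d1 -> y d = y d1 by move=> dd; exact: face_invariant dd.
have Brev d : is_dart d -> B d -> B (rev d).
  move=> dd; have := yx d dd; rewrite /x /B.
  case dW: (d \in W); case rW: (rev d \in W); rewrite ?orbT ?orbF //=.
    by rewrite (yface d (Wface _ dW)); case: (y d1); case: (y _).
  by case: (y d1); case: (y _); case: (y _).
have Bphi d : is_dart d -> d.2 <> d1.1 -> B d -> B (phi d).
  move=> dd dv; rewrite /B yphi //; case/orP=> [->//|/WP[i ik e]].
  have [ik1|ik1] := ltnP i.+1 k.
    by apply/orP; right; apply/WP; exists i.+1; rewrite // e.
  have ki : k = i.+1 by lia.
  by case: dv; rewrite -tail -kE ki e.
have Bstar w u u' : w <> d1.1 -> adj w u -> adj w u' -> B (w, u) -> B (w, u').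
  move=> wv wu wu'; apply: (rotate_invariant (Q := B)) => // d dd dw Bd.
  by apply: Bphi; rewrite ?dart_rev //= ?dw //; exact: Brev.
case: G_2conn => _ _ /(_ d1.1 d1.2 d2.2).
have neqs d : is_dart d -> d.1 = d1.1 -> d.2 != d1.1.
  by move=> /dart_neq + e; rewrite -e eq_sym.
have dd2 : is_dart d2 by exact: face_dart d2d1.
move=> /(_ (neqs _ dd1 erefl) (neqs _ dd2 tail)) /connectP[p].
have : exists2 u, adj d1.2 u & B (d1.2, u).
  exists d1.1; first by rewrite adj_sym.
  by apply: (Brev d1) => //; rewrite /B d1W orbT.
elim: p (d1.2) (neqs _ dd1 erefl) => [|w p IHp] z zv [u zu Bu] /=.
  move=> _ zE; have adjz : adj z d1.1 by rewrite -zE -tail adj_sym.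
  have := Brev (z, d1.1) adjz (Bstar _ _ _ (elimN eqP zv) zu adjz Bu).
  have -> : rev (z, d1.1) = d2 by rewrite -zE -tail; case: (d2).
  by rewrite /B (negPf d2W) orbF yface // addbb.
case/andP=> /and3P[zw _ wv] wp; apply: IHp => //.
exists z; first by rewrite adj_sym.
exact: (Brev (z, w) zw (Bstar z u w (elimN eqP zv) zu zw Bu)).
Qed.

(** A face with both darts of an edge turns back at its end, which then has degree
    one; but the neighbour would be a cut vertex. *)
Lemma rev_not_in_face d : is_dart d -> rev d \notin face d.
Proof.
move=> dd; apply/negP => rd.
have step : phi d = rev d.
  apply: face_tail_inj; rewrite ?dart_rev //.
  by rewrite mem_face ?dart_rev ?dart_step // (face_eq dd rd) face_step_eq.
have only u : adj d.2 u -> u = d.1.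
  move=> u2; have d21 : adj d.2 d.1 by rewrite adj_sym.
  have /iter_findex <- := rot_cyclic d21 u2.
  elim: (findex _ _ _) => //= i ->; by case: step.
case: G_2conn => G3 _ conn; have : exists z, (z != d.1) && (z != d.2).
  apply/existsP; apply: contraLR G3; rewrite negb_exists -leqNgt => /forallP all12.
  apply: (@leq_trans #|[set d.1; d.2]|); last by rewrite cards2; case: (_ != _).
  rewrite -cardsT subset_leq_card //; apply/subsetP => z _; rewrite !inE.
  by have := all12 z; rewrite negb_and !negbK.
case=> z /andP[z1 z2].
have := conn d.1 d.2 z; rewrite eq_sym dart_neq // => /(_ isT z1) /connectP[[|w p]] /=.
  by move=> _ e; rewrite e eqxx in z2.
by case/andP=> /and3P[/only-> _]; rewrite eqxx.
Qed.

End TwoConnected.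

(** * Perfect matchings of outerplane bipartite graphs *)

Section GraphMatching.
Variable G : sgraph.
Local Notation edge := (@edge_of G).

Lemma perfect_matchingP (N : {set {set G}}) :
  reflect (N \subset edges G /\
    forall v, \sum_(d | is_dart d && (d.1 == v)) (edge d \in N : nat) = 1)
  (perfect_matching N).
Proof.
have count v : N \subset edges G ->
    \sum_(d | is_dart d && (d.1 == v)) (edge d \in N : nat)
    = #|[set e in N | v \in e]|.
  move=> sub; rewrite -(sum_star _ v (fun e => (e \in N : nat))).
  rewrite -big_mkcondr sum1dep_card; apply: eq_card => e.
  rewrite !inE; case eN: (e \in N); rewrite ?andbF // andbT (subsetP sub) //.
apply: (iffP andP) => -[sub N1]; split=> //.
  by move=> v; rewrite count //; apply/eqP; exact: (forall_inP N1).
by apply/forallP => v; rewrite -count // N1 implybT.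
Qed.

End GraphMatching.

Section Outerplane.
Variable G : plane_graph.
Hypothesis G_2conn : two_connected G.
Hypothesis G_outer : outerplane G.
Variable c : G -> bool.
Hypothesis c_proper : forall u v : G, adj u v -> c u != c v.
Local Notation D := (G * G)%type.
Local Notation rev := (@rev_dart G).
Local Notation edge := (@edge_of G).
Local Notation phi := (face_step (@Defs.rot G)).
Local Notation face := (face_of (@Defs.rot G)).

Definition outer d := d \in exterior_face G.

(** Colours alternate along a face, so that the two colours are the two perfect
    matchings of a face cycle; the two darts of an edge have opposite colours. *)
Definition tail_color (d : D) := c d.1.

Lemma outer_is_dart d : outer d -> is_dart d.
Proof. by apply: face_dart; exact: outer_dart_adj. Qed.

Lemma outerE d : is_dart d -> outer d = (face d == exterior_face G).
Proof. by move=> dd; rewrite /outer mem_face //; exact: outer_dart_adj. Qed.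

Lemma outer_step d : is_dart d -> outer (phi d) = outer d.
Proof. by move=> dd; rewrite !outerE ?dart_step // face_step_eq. Qed.

Lemma outer_rev d : outer d -> ~~ outer (rev d).
Proof.
move=> od; have dd := outer_is_dart od.
have := rev_not_in_face G_2conn dd; rewrite mem_face ?dart_rev // !outerE ?dart_rev //.
by move: od; rewrite outerE // => /eqP ->.
Qed.

Lemma outer_tail_inj d d' : outer d -> outer d' -> d.1 = d'.1 -> d = d'.
Proof.
move=> od od'; have dd := outer_is_dart od; have dd' := outer_is_dart od'.
apply: (face_tail_inj G_2conn) => //; rewrite mem_face //.
by move: od od'; rewrite !outerE // => /eqP -> /eqP ->.
Qed.

Lemma outer_tail v : exists2 d, outer d & d.1 = v.
Proof.
have /bigcupP[_ /imsetP[d od ->]] := G_outer v; rewrite !inE.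
case/orP=> /eqP ->; first by exists d.
by exists (phi d); rewrite // outer_step //; exact: outer_is_dart.
Qed.

Lemma tail_color_rev d : is_dart d -> tail_color (rev d) = ~~ tail_color d.
Proof. by move=> /c_proper; rewrite /tail_color /=; case: (c _); case: (c _). Qed.

Lemma tail_color_step d : is_dart d -> tail_color (phi d) = ~~ tail_color d.
Proof. exact: tail_color_rev. Qed.

Lemma sum_at_outer (R : Type) (idx : R) (op : Monoid.com_law idx) v (F : D -> R) d0 :
  outer d0 -> d0.1 = v -> (forall d, ~~ outer d -> F d = idx) ->
  \big[op/idx]_(d | is_dart d && (d.1 == v)) F d = F d0.
Proof.
move=> od0 d0v F0; rewrite (bigD1 d0) /=; last by rewrite (outer_is_dart od0) d0v eqxx.
rewrite big1 ?Monoid.mulm1 // => d /andP[/andP[dd /eqP dv] dd0]; apply: F0.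
by apply: contraNN dd0 => od; apply/eqP; apply: outer_tail_inj; rewrite // dv.
Qed.

(** Rotation permutes the darts that leave v. *)
Lemma sum_rotate (R : Type) (idx : R) (op : Monoid.com_law idx) v (F : D -> R) :
  \big[op/idx]_(d | is_dart d && (d.1 == v)) F (phi (rev d)) =
  \big[op/idx]_(d | is_dart d && (d.1 == v)) F d.
Proof.
pose A := [set d : D | is_dart d && (d.1 == v)].
pose h d := phi (rev d).
have hinj : {in A &, injective h}.
  move=> d d'; rewrite !inE => /andP[dd _] /andP[dd' _] /step_inj e.
  by apply: (can_inj (@rev_dartK G)); apply: e; rewrite -[_ \in _]/(is_dart _) dart_rev.
have hA : h @: A = A.
  apply/eqP; rewrite eqEcard card_in_imset // leqnn andbT.
  apply/subsetP => _ /imsetP[d + ->]; rewrite !inE => /andP[dd dv].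
  by rewrite dart_step ?dart_rev.
transitivity (\big[op/idx]_(d in A) F (h d)); first by apply: eq_bigl => d; rewrite inE.
by rewrite -big_imset // hA; apply: eq_bigl => d; rewrite inE.
Qed.

Definition facewise (y : D -> bool) := forall d, is_dart d -> y (phi d) = y d.

(** Going round v from the exterior face back to it, count the faces whose value is
    the colour of v, the exterior face being counted at the start and not at the
    end. Rotation shifts the second sum into the first, up to the one exterior dart
    at v. *)
Lemma vertex_count y v : facewise y ->
  \sum_(d | is_dart d && (d.1 == v)) (outer d || (y d == c v)) =
  1 + \sum_(d | is_dart d && (d.1 == v)) (~~ outer (rev d) && (y (rev d) == c v)).
Proof.
move=> yphi; have [d0 od0 d0v] := outer_tail v.
have {1}-> : 1 = \sum_(d | is_dart d && (d.1 == v)) outer d.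
  by rewrite (sum_at_outer _ od0 d0v) ?od0 // => d /negPf->.
have -> : \sum_(d | is_dart d && (d.1 == v)) (~~ outer (rev d) && (y (rev d) == c v))
        = \sum_(d | is_dart d && (d.1 == v)) (~~ outer d && (y d == c v)).
  rewrite -(sum_rotate _ v (fun d => ~~ outer d && (y d == c v) : nat)).
  by apply: eq_bigr => d /andP[dd _]; rewrite outer_step ?yphi ?dart_rev.
rewrite -big_split /=; apply: eq_bigr => d _.
by case: (outer d); case: (_ == _).
Qed.

(** The matching coded by y: an edge belongs to it when y agrees with the colour of
    its dart on each interior side. *)
Definition matched (y : D -> bool) d :=
  (outer d || (y d == tail_color d)) &&
  (outer (rev d) || (y (rev d) == tail_color (rev d))).

Definition matching_of (y : D -> bool) : {set {set G}} :=
  [set edge d | d in [pred d | is_dart d && matched y d]].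

(** The value of y is wrong on at most one side of each interior edge. *)
Definition consistent (y : D -> bool) := forall d, is_dart d ->
  ~~ outer d -> ~~ outer (rev d) ->
  (y d == tail_color d) || (y (rev d) == tail_color (rev d)).

Lemma matched_rev y d : matched y (rev d) = matched y d.
Proof. by rewrite /matched rev_dartK andbC. Qed.

Lemma mem_matching_of y d : is_dart d -> (edge d \in matching_of y) = matched y d.
Proof.
move=> dd; apply/imsetP/idP => [[d' /andP[dd' md'] e]|md].
  by case: (edge_eq dd dd' e) md' => ->; rewrite ?matched_rev.
by exists d => //; apply/andP.
Qed.

(** By consistency the difference of the summands of [vertex_count] at a dart is 1 or
    0, according to whether the edge is in the matching. *)
Lemma matching_of_perfect y : facewise y -> consistent y ->
  perfect_matching (matching_of y).
Proof.
move=> yphi cons; apply/perfect_matchingP; split.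
  by apply/subsetP => _ /imsetP[d /andP[dd _] ->]; exact: edge_in.
move=> v; apply: (@addIn (\sum_(d | is_dart d && (d.1 == v))
                             (~~ outer (rev d) && (y (rev d) == c v)))).
rewrite -vertex_count // -big_split /=; apply: eq_bigr => d /andP[dd /eqP dv].
rewrite mem_matching_of // /matched tail_color_rev // /tail_color dv.
have := cons d dd; rewrite tail_color_rev // /tail_color dv.
case od: (outer d); case or: (outer (rev d)) => //=; rewrite ?andbT ?addn0 //;
  try (by case: (y _); case: (y _); case: (c v) => // /(_ isT isT));
  by case: (y _); case: (c v).
Qed.

(** The exterior edges whose exterior dart is coloured [true] form a perfect matching
    too; the sum of N and this matching modulo 2 has even degrees, and y selects the
    faces whose boundaries add up to it, the exterior face excluded. For an interior
    edge of N this determines y only up to the exchange of its two sides; the right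
    one follows from [vertex_count], where all other darts at its end cancel. *)
Lemma perfect_matching_of_facewise N : perfect_matching N ->
  exists y, [/\ facewise y, consistent y & N = matching_of y].
Proof.
move=> /perfect_matchingP[subN N1].
pose x d := (edge d \in N) (+)
  ((outer d && tail_color d) (+) (outer (rev d) && tail_color (rev d))).
have [|v|y0 [y0phi y0x]] := @even_set_is_boundary G x.
- by move=> d _; rewrite /x edge_rev rev_dartK; congr (_ (+) _); rewrite addbC.
- rewrite big_split big_split /=.
  have -> : \big[addb/false]_(d | is_dart d && (d.1 == v)) (edge d \in N) = true.
    rewrite -[LHS]oddb -[true]/(odd 1) -(N1 v).
    rewrite (big_morph odd oddD (id1 := false)) // oddb.
    by apply: eq_bigr => d _; rewrite oddb.
  have [d0 od0 d0v] := outer_tail v.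
  rewrite (sum_at_outer _ od0 d0v) => [|d /negPf->//].
  have -> : \big[addb/false]_(d | is_dart d && (d.1 == v))
              (outer (rev d) && tail_color (rev d))
          = outer d0 && ~~ tail_color d0.
    have no_outer d : ~~ outer d -> outer d && ~~ tail_color d = false by move/negPf->.
    rewrite -(sum_at_outer addb od0 d0v no_outer).
    rewrite -(sum_rotate addb v (fun d => outer d && ~~ tail_color d)).
    apply: eq_bigr => d /andP[dd _].
    by rewrite outer_step ?dart_rev // tail_color_step ?dart_rev // negbK.
  by rewrite od0; case: (tail_color d0).
pose o := outer_dart G; have od : is_dart o := outer_dart_adj G.
(* Normalised so as not to select the exterior face. *)
pose y d := y0 d (+) y0 o.
have yphi : facewise y by move=> d dd; rewrite /y y0phi.
have yx d : is_dart d -> x d = y d (+) y (rev d).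
  by move=> dd; rewrite y0x // /y addbACA addbb addbF.
have y_outer d : outer d -> y d = false.
  by move=> d_outer; rewrite /y (face_invariant y0phi od d_outer) addbb.
have N_outer d : outer d -> (edge d \in N) = (y (rev d) == tail_color (rev d)).
  move=> d_outer; have dd := outer_is_dart d_outer; have := yx d dd.
  rewrite /x d_outer (negPf (outer_rev d_outer)) (y_outer d) // tail_color_rev //=.
  by case: (_ \in N); case: (tail_color d); case: (y _).
have N_inner d : is_dart d -> ~~ outer d -> ~~ outer (rev d) ->
    (edge d \in N) = (y d != y (rev d)).
  move=> dd /negPf dn /negPf rn; have := yx d dd; rewrite /x dn rn /=.
  by case: (_ \in N); case: (y d); case: (y _).
have N_matched d : is_dart d -> edge d \in N -> matched y d.
  move=> dd dN; have := vertex_count d.1 yphi.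
  have := N1 d.1; rewrite !(bigD1 d (P := fun d' => is_dart d' && _)) ?dd ?eqxx //= dN.
  move=> /eqP; rewrite eqSS sum_nat_eq0 => /forallP others.
  rewrite [X in _ + X = _](_ : _ = \sum_(d' | (is_dart d' && (d'.1 == d.1)) && (d' != d))
     (~~ outer (rev d') && (y (rev d') == c d.1))); last first.
    apply: eq_bigr => d' /andP[/andP[dd' /eqP d'1] d'd].
    have := others d'; rewrite dd' d'1 eqxx d'd /= eqb0 => d'N.
    have rd' : is_dart (rev d') by rewrite dart_rev.
    case o1: (outer d').
      move: d'N; rewrite (N_outer d') // (outer_rev o1) tail_color_rev // /tail_color d'1.
      by case: (y _); case: (c _).
    case o2: (outer (rev d')).
      move: d'N; rewrite -edge_rev (N_outer (rev d')) // rev_dartK /tail_color d'1.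
      by move/negPf->.
    by move: d'N; rewrite N_inner ?o1 ?o2 // negbK => /eqP->.
  rewrite addnA => /addIn; rewrite /matched tail_color_rev // /tail_color.
  case: (outer d); case: (outer (rev d)); case: (y d); case: (y (rev d));
    by case: (c d.1).
exists y; split=> //.
- move=> d dd dn rn; case dN: (edge d \in N).
    by have := N_matched d dd dN; rewrite /matched (negPf dn) (negPf rn) /= => /andP[->].
  move: dN; rewrite N_inner // tail_color_rev // => /negbFE/eqP->.
  by case: (y _); case: (tail_color d).
- apply/setP => e; apply/idP/imsetP => [eN|[d /andP[dd md] ->]].
    have /mem_edges[d dd e_d] := subsetP subN e eN.
    exists d => //; apply/andP; split=> //.
    by apply: N_matched => //; rewrite -e_d.
  move: md; rewrite /matched; case o1: (outer d).
    by rewrite N_outer // (negPf (outer_rev o1)).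
  case o2: (outer (rev d)).
    by rewrite /= andbT -edge_rev (N_outer (rev d)) // rev_dartK.
  rewrite N_inner ?o1 ?o2 // tail_color_rev //=.
  by case: (y d); case: (y _); case: (tail_color d).
Qed.

End Outerplane.

(** * Interior faces *)

Section FaceCycles.
Variable G : plane_graph.
Hypothesis G_2conn : two_connected G.
Local Notation D := (G * G)%type.
Local Notation rev := (@rev_dart G).
Local Notation edge := (@edge_of G).
Local Notation phi := (face_step (@Defs.rot G)).
Local Notation face := (face_of (@Defs.rot G)).
Local Notation bd d := (boundary (face d)).

Lemma mem_boundary d d' : is_dart d -> is_dart d' ->
  (edge d' \in bd d) = (face d' == face d) || (face (rev d') == face d).
Proof.
move=> dd dd'; have rd' : is_dart (rev d') by rewrite dart_rev.
apply/imsetP/orP => [[a ad e]|]; last first.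
  case=> [fd|fd]; first by exists d' => //; rewrite mem_face.
  by exists (rev d'); rewrite ?mem_face // -edge_rev.
have da := face_dart dd ad; rewrite mem_face // in ad.
by case: (edge_eq dd' da e) ad => ->; [left | right].
Qed.

Lemma edge_inj_face d : is_dart d -> {in face d &, injective edge}.
Proof.
move=> dd a b ad bd e; have da := face_dart dd ad; have db := face_dart dd bd.
case: (edge_eq da db e) => // ba; have := rev_not_in_face G_2conn da.
by rewrite -ba mem_face // (face_eq dd ad) (face_eq dd bd) eqxx.
Qed.

Lemma card_boundary d : is_dart d -> #|bd d| = #|face d|.
Proof. by move=> dd; rewrite card_in_imset //; exact: edge_inj_face. Qed.

Lemma face_gt2 d : is_dart d -> 2 < #|face d|.
Proof.
move=> dd; have dd1 := dart_step dd; have dd2 := dart_step dd1.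
have sub : {subset [:: d; phi d; phi (phi d)] <= face d}.
  move=> a; rewrite !inE => /or3P[]/eqP->; rewrite ?connect0 ?fconnect1 //.
  exact: connect_trans (fconnect1 _ _) (fconnect1 _ _).
have neq a : is_dart a -> phi a != a.
  by move=> da; apply: contraTneq (dart_neq da) => e; rewrite -{1}e eqxx.
have uniq3 : uniq [:: d; phi d; phi (phi d)].
  rewrite /= !inE negb_or (eq_sym d) neq // (eq_sym (phi d)) neq // !andbT /=.
  apply: contraNneq (rev_not_in_face G_2conn dd) => e.
  have -> : rev d = phi d; last by rewrite inE fconnect1.
  by rewrite [phi d]surjective_pairing /rev_dart {2}e.
rewrite cardE; apply: (uniq_leq_size uniq3) => a /sub.
by rewrite mem_enum.
Qed.

Lemma boundary_is_cycle d : is_dart d -> is_cycle (bd d).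
Proof.
move=> dd; pose p := map fst (orbit phi d).
have memo a : (a \in orbit phi d) = (a \in face d) by rewrite -fconnect_orbit inE.
have pU : uniq p.
  rewrite map_inj_in_uniq ?orbit_uniq // => a b; rewrite !memo => ad bd e.
  apply/esym/(face_tail_inj G_2conn) => //; first exact: face_dart ad.
  by rewrite mem_face ?(face_dart dd ad) ?(face_dart dd bd) // !(face_eq dd) ?eqxx.
have size_p : size p = #|face d|.
  by rewrite size_map -(card_uniqP (orbit_uniq phi d)); apply: eq_card => a; rewrite memo.
have size_le : #|face d| < #|G|.+1 by rewrite ltnS -size_p -(card_uniqP pU) max_card.
apply/existsP; exists (Ordinal size_le); apply/existsP.
have /eqP sp : size p == Ordinal size_le by rewrite size_p.
exists (tcast sp (in_tuple p)); rewrite val_tcast /= face_gt2 // pU /=.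
have next_p x : x \in p -> (x, next p x) \in face d.
  move=> xp; apply: (next_cycle (e := fun x y => (x, y) \in face d)) xp.
  apply: (homo_cycle_in (P := fun a => a \in face d) (e := frel phi)).
  - by move=> a b ad _ /eqP <- /=; rewrite -surjective_pairing.
  - by apply/allP => a; rewrite memo.
  - by apply: cycle_orbit_in (dd); [exact: dart_step | exact: step_inj].
have memt x : (x \in tcast sp (in_tuple p)) = (x \in p) by rewrite memtE val_tcast.
apply/eqP/setP => e; apply/imsetP/imsetP => [[a ad ->]|[x + ->]]; last first.
  by rewrite memt => xp; exists (x, next p x); first exact: next_p.
have ap : a.1 \in p by apply: map_f; rewrite memo.
exists a.1; first by rewrite memt.
apply: (congr1 edge (x := a) (y := (a.1, next p a.1))).
have nd := next_p _ ap; apply: (face_tail_inj G_2conn) => //; first exact: face_dart nd.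
by rewrite mem_face ?(face_dart dd ad) ?(face_dart dd nd) // !(face_eq dd) ?eqxx.
Qed.

Definition inner (d : D) := is_dart d && ~~ outer d.

Lemma inner_face d d' : inner d -> d' \in face d -> inner d'.
Proof.
case/andP=> dd nd d'd; rewrite /inner (face_dart dd d'd) outerE ?(face_dart dd d'd) //.
by rewrite (face_eq dd d'd) -outerE.
Qed.

(** Two faces with the same boundary would be closed under reversal of darts, so they
    would be all faces; but the exterior face is different from both. *)
Lemma boundary_inj d d' : inner d -> inner d' -> bd d = bd d' -> face d = face d'.
Proof.
case/andP=> dd od /andP[dd' od'] e; apply/eqP/negPn/negP => neq.
pose P a := (face a == face d) || (face a == face d').
have Prev0 a : is_dart a -> P a -> P (rev a).
  move=> da; have ra : is_dart (rev a) by rewrite dart_rev.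
  have e1 := mem_boundary dd da; have e2 := mem_boundary dd' da.
  rewrite e e2 in e1; rewrite /P; case/orP=> fa.
    by move: e1; rewrite fa (eqP fa) (negPf neq) /= => ->; rewrite orbT.
  by move: e1; rewrite fa (eqP fa) (eq_sym (face d')) (negPf neq) /= => <-.
have Prev a : is_dart a -> P (rev a) = P a.
  move=> da; apply/idP/idP; last exact: Prev0.
  by rewrite -{2}[a]rev_dartK; apply: Prev0; rewrite dart_rev.
have Pphi a : is_dart a -> P (phi a) = P a by move=> da; rewrite /P face_step_eq.
have := map_connected Pphi Prev dd (outer_dart_adj G).
rewrite /P eqxx /= => /esym/orP[]/eqP fo.
  by move: od; rewrite outerE // /exterior_face fo eqxx.
by move: od'; rewrite outerE // /exterior_face fo eqxx.
Qed.

Lemma inner_facesP f :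
  reflect (exists2 d, inner d & f = face d) (f \in faces G :\ exterior_face G).
Proof.
rewrite in_setD1; apply: (iffP andP) => [[ne /facesP[d dd fd]]|[d /andP[dd od] ->]].
  by exists d; rewrite // /inner dd outerE // -fd.
by rewrite -outerE // od face_in.
Qed.

Lemma face_cyclesP C :
  reflect (exists2 d, inner d & C = bd d) (C \in face_cycles G).
Proof.
rewrite inE; apply: (iffP andP) => [[_ /imsetP[f /inner_facesP[d id ->] ->]]|[d id ->]].
  by exists d.
have /andP[dd _] := id; split; first exact: boundary_is_cycle.
by apply/imsetP; exists (face d) => //; apply/inner_facesP; exists d.
Qed.

Lemma card_face_cycles : #|face_cycles G|.+1 = #|faces G|.
Proof.
have ext : exterior_face G \in faces G by apply: face_in; exact: outer_dart_adj.
rewrite (cardsD1 (exterior_face G) (faces G)) ext; congr _.+1.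
rewrite -(card_in_imset (f := @boundary G)).
  apply: eq_card => C; rewrite inE andb_idl // => /imsetP[f /inner_facesP[d]].
  by case/andP=> dd _ -> ->; exact: boundary_is_cycle.
move=> f f' /inner_facesP[d id ->] /inner_facesP[d' id' ->]; exact: boundary_inj.
Qed.

End FaceCycles.

(** * The chain of faces *)

Section Chain.
Variable G : plane_graph.
Hypothesis G_2conn : two_connected G.
Hypothesis G_outer : outerplane G.
Local Notation D := (G * G)%type.
Local Notation rev := (@rev_dart G).
Local Notation edge := (@edge_of G).
Local Notation phi := (face_step (@Defs.rot G)).
Local Notation face := (face_of (@Defs.rot G)).
Local Notation bd d := (boundary (face d)).
Variable s : seq {set {set G}}.
Hypothesis s_chain : chain_labelling s.
Local Notation n := (size s).

Definition pos (d : D) := index (bd d) s.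

Lemma mem_chain C : (C \in s) = (C \in face_cycles G).
Proof. by case: s_chain => _ ->. Qed.

Lemma chain_uniq : uniq s. Proof. by case: s_chain. Qed.

Lemma boundary_in_chain d : inner d -> bd d \in s.
Proof. by move=> id; rewrite mem_chain; apply/(face_cyclesP G_2conn); exists d. Qed.

Lemma pos_lt d : inner d -> pos d < n.
Proof. by move=> id; rewrite index_mem boundary_in_chain. Qed.

Lemma nth_pos d : inner d -> nth set0 s (pos d) = bd d.
Proof. by move=> id; rewrite nth_index ?boundary_in_chain. Qed.

Lemma pos_step d : is_dart d -> pos (phi d) = pos d.
Proof. by move=> dd; rewrite /pos face_step_eq. Qed.

Lemma pos_eq d d' : inner d -> inner d' -> (pos d == pos d') = (face d == face d').
Proof.
move=> id id'; apply/eqP/eqP => [e|e]; last by rewrite /pos e.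
by apply: boundary_inj => //; rewrite -!nth_pos // e.
Qed.

Lemma pos_surj i : i < n -> exists2 d, inner d & pos d = i.
Proof.
move=> ilt; have : nth set0 s i \in face_cycles G by rewrite -mem_chain mem_nth.
case/(face_cyclesP G_2conn) => d id e; exists d => //.
by rewrite /pos -e index_uniq ?chain_uniq.
Qed.

Lemma edge_in_cycle d i : is_dart d -> i < n ->
  (edge d \in nth set0 s i) =
  (inner d && (pos d == i)) || (inner (rev d) && (pos (rev d) == i)).
Proof.
move=> dd /pos_surj[d0 id0 <-]; have /andP[dd0 od0] := id0.
have face_inner a : is_dart a -> (face a == face d0) = inner a && (pos a == pos d0).
  move=> da; apply/idP/andP => [fa|[ia]]; last by rewrite pos_eq.
  have ia : inner a by apply: inner_face id0 _; rewrite mem_face.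
  by rewrite ia pos_eq.
by rewrite nth_pos // mem_boundary // !face_inner ?dart_rev.
Qed.

Definition is_crossing i (d : D) :=
  [&& inner d, inner (rev d), pos d == i & pos (rev d) == i.+1].

(** The dart of face i whose reverse lies in face i.+1; it gives the edge shared by
    these faces. The default value is used only if i.+1 is not a face. *)
Definition crossing i : D := odflt (outer_dart G) [pick d | is_crossing i d].

Lemma crossingP i : i.+1 < n -> is_crossing i (crossing i).
Proof.
move=> i1n; rewrite /crossing; case: pickP => [d //|none].
case: s_chain => _ _ /(sortedP set0)/(_ i i1n)/andP[_ /set0Pn[e]].
have i_lt := ltnW i1n; rewrite inE.
have [d0 id0 pd0] := pos_surj i_lt; rewrite -{1}pd0 nth_pos //.
case/andP=> /imsetP[d dd ->]; have id := inner_face id0 dd.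
have /andP[d_dart _] := id; rewrite edge_in_cycle //.
have pd : pos d = i.
  by rewrite -pd0; apply/eqP; rewrite pos_eq // -mem_face //; case/andP: id0.
rewrite pd ltn_eqF // andbF /= => /andP[ird prd].
by have := none d; rewrite /is_crossing id ird pd prd eqxx.
Qed.

Lemma crossing_inj i j : i.+1 < n -> j.+1 < n ->
  edge (crossing i) = edge (crossing j) -> i = j.
Proof.
move=> /crossingP/and4P[/andP[di _] _ /eqP pi /eqP pri].
move=> /crossingP/and4P[/andP[dj _] _ /eqP pj /eqP prj] e.
by case: (edge_eq di dj e) pj prj => ->; rewrite ?rev_dartK ?pi ?pri; lia.
Qed.

(** The exterior face passes once through every vertex, so Euler's formula leaves one
    edge less than interior faces off the exterior face. *)
Lemma card_inner_edges :
  #|[set e in edges G | e \notin [set edge d | d in exterior_face G]]|.+1 = n.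
Proof.
pose X := [set edge d | d in exterior_face G].
have cardX : #|X| = #|G|.
  rewrite card_in_imset; last first.
    by apply: edge_inj_face => //; exact: outer_dart_adj.
  rewrite -cardsT -(card_in_imset (f := fst) (D := exterior_face G)); last first.
    by move=> d d' od od'; exact: (outer_tail_inj G_2conn).
  apply: eq_card => v; rewrite inE; apply/imsetP.
  by have [d od dv] := outer_tail G_outer v; exists d.
have subX : X \subset edges G.
  by apply/subsetP => _ /imsetP[d od ->]; apply/edge_in/outer_is_dart.
have -> : [set e in edges G | e \notin X] = edges G :\: X.
  by apply/setP => e; rewrite !inE andbC.
have := euler_formula G; rewrite -/(faces G) -(card_face_cycles G_2conn).
rewrite cardsDS // cardX; have := subset_leq_card subX; rewrite cardX.
have -> : #|face_cycles G| = n.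
  by rewrite -(card_uniqP chain_uniq); apply: eq_card => C; rewrite -mem_chain.
move=> VE euler; apply/eqP; rewrite -(eqn_add2l #|G|) addnS subnKC //.
by move/eqP: euler; rewrite addnS addn2 eqSS eq_sym.
Qed.

(** The n.-1 edges between consecutive faces exhaust the edges off the exterior
    face. *)
Lemma shared_dart d : inner d -> inner (rev d) ->
  exists2 i, i.+1 < n & d = crossing i \/ d = rev (crossing i).
Proof.
move=> id ird; have /andP[dd od] := id; have /andP[_ ord] := ird.
pose I := [set e in edges G | e \notin [set edge d | d in exterior_face G]].
pose f (i : 'I_n.-1) := edge (crossing i).
have i1n (i : 'I_n.-1) : i.+1 < n by case: i => i /=; lia.
have finj : injective f by move=> i j /(crossing_inj (i1n i) (i1n j)) e; exact: val_inj.
have inI d' : inner d' -> inner (rev d') -> edge d' \in I.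
  move=> /andP[dd' od'] /andP[_ or']; rewrite inE edge_in //=.
  apply/imsetP => -[a oa e]; have da := outer_is_dart oa.
  by case: (edge_eq dd' da e) oa => ->; apply/negP.
have : f @: 'I_n.-1 = I.
  apply/eqP; rewrite eqEcard card_imset // card_ord -ltnS card_inner_edges.
  rewrite andbC leqSpred /=; apply/subsetP => _ /imsetP[i _ ->].
  by have /and4P[? ? _ _] := crossingP (i1n i); exact: inI.
move=> fI; have := inI d id ird; rewrite -fI => /imsetP[i _ e].
exists i => //; have /and4P[/andP[dc _] _ _ _] := crossingP (i1n i).
by case: (edge_eq dc dd (esym e)) => ->; [left | right].
Qed.

End Chain.

(** * Words and perfect matchings *)

Section Words.
Variable G : plane_graph.
Hypothesis G_2conn : two_connected G.
Hypothesis G_outer : outerplane G.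
Variable c : G -> bool.
Hypothesis c_proper : forall u v : G, adj u v -> c u != c v.
Local Notation D := (G * G)%type.
Local Notation rev := (@rev_dart G).
Local Notation edge := (@edge_of G).
Local Notation phi := (face_step (@Defs.rot G)).
Local Notation face := (face_of (@Defs.rot G)).
Local Notation bd d := (boundary (face d)).
Variable s : seq {set {set G}}.
Hypothesis s_chain : chain_labelling s.
Local Notation n := (size s).
Local Notation pos := (@pos G s).
Local Notation crossing := (@crossing G s).
Local Notation tail_color := (@tail_color G c).

Definition face_class d b := [set a in face d | tail_color a == b].

Lemma in_face_class d b a :
  (a \in face_class d b) = (a \in face d) && (tail_color a == b).
Proof. by rewrite in_set. Qed.

(** The face step exchanges the two colours. *)
Lemma card_face_class d b : is_dart d -> #|face d| = #|face_class d b|.*2.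
Proof.
move=> dd; have leX b' : #|face_class d b'| <= #|face_class d (~~ b')|.
  rewrite -(card_in_imset (f := phi) (D := face_class d b')); last first.
    move=> a a'; rewrite !in_face_class => /andP[ad _] /andP[ad' _].
    by apply: step_inj; [exact: (face_dart dd) | exact: (face_dart dd)].
  apply/subset_leq_card/subsetP => _ /imsetP[a + ->].
  rewrite !in_face_class => /andP[ad /eqP ca].
  have da := face_dart dd ad; rewrite tail_color_step // ca eqxx andbT.
  by rewrite mem_face ?dart_step // face_step_eq // (face_eq dd ad).
have eqX : #|face_class d (~~ b)| = #|face_class d b|.
  by apply/eqP; rewrite eqn_leq leX andbT -{2}[b]negbK leX.
rewrite -addnn -{2}eqX -(cardsID (face_class d b) (face d)).
congr (_ + _); apply: eq_card => a.
  by rewrite in_setI in_face_class andbA andbb.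
rewrite in_setD !in_face_class.
by case: (a \in face d); case: (tail_color a); case: (b).
Qed.

Definition slope i := tail_color (crossing i).
Definition square i := #|nth set0 s i| == 4.
Definition letter (w : nat -> bool) (d : D) := w (pos d).

Local Notation avail := (available n slope square).
Local Notation usable := (usable n slope square).
Local Notation holds := (holds slope).

Lemma crossing_facts i : i.+1 < n ->
  [/\ inner (crossing i), inner (rev (crossing i)), pos (crossing i) = i
    & pos (rev (crossing i)) = i.+1].
Proof. by move=> /(crossingP G_2conn s_chain)/and4P[? ? /eqP ? /eqP]. Qed.

Lemma tail_color_rev_crossing i : i.+1 < n -> tail_color (rev (crossing i)) = ~~ slope i.
Proof. by move=> /crossing_facts[/andP[dd _] _ _ _]; rewrite tail_color_rev. Qed.

Lemma letter_facewise w : facewise (letter w).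
Proof. by move=> d dd; rewrite /letter pos_step. Qed.

Lemma consistent_letter w : valid n slope 0 w <-> consistent c (letter w).
Proof.
split=> [vw d dd dn rn | cons i _ i1n].
  have id : inner d by rewrite /inner dd.
  have ird : inner (rev d) by rewrite /inner dart_rev dd.
  have [i i1n di] := shared_dart G_2conn G_outer s_chain id ird.
  have [_ _ p1 p2] := crossing_facts i1n; have c2 := tail_color_rev_crossing i1n.
  have := vw i isT i1n; case: di => ->; rewrite ?rev_dartK /letter p1 p2 c2 -/(slope i).
    by case: (w i.+1); case: (slope i); rewrite ?orbT ?orbF.
  by case: (w i.+1); case: (slope i); rewrite ?orbT ?orbF.
have [/andP[dd o1] /andP[_ o2] p1 p2] := crossing_facts i1n.
have := cons _ dd o1 o2; rewrite /letter p1 p2 tail_color_rev_crossing //.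
by rewrite -/(slope i); case: (w i.+1); case: (slope i).
Qed.

(** A face has at least two edges of colour b. If none of them is free, they are the
    edges shared with the previous and with the next face: these have the same
    colour, and there are only four edges. *)
Lemma free_dart i b : i < n -> avail i b ->
  exists d, [/\ inner d, pos d = i, tail_color d = b & outer (rev d)].
Proof.
move=> ilt av; have [d0 id0 pd0] := pos_surj G_2conn s_chain ilt.
have /andP[dd0 _] := id0.
pose X := face_class d0 b.
have cardX : #|face d0| = #|X|.*2 by exact: card_face_class.
have bd_nth : nth set0 s i = bd d0 by rewrite -pd0 nth_pos.
have fourE : square i = (#|X| == 2).
  by rewrite /square bd_nth card_boundary // cardX -[4]/(2.*2) -!muln2 eqn_pmul2r.
have X2 : 1 < #|X| by have := face_gt2 G_2conn dd0; rewrite cardX; case: #|X| => [|[|]].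
have [/existsP[d /andP[]]|none] := boolP [exists d in X, outer (rev d)].
  rewrite in_face_class => /andP[dd /eqP cd] od; exists d; split=> //.
    exact: inner_face dd.
  have id := inner_face id0 dd.
  by rewrite -pd0; apply/eqP; rewrite pos_eq // -mem_face //; case/andP: id.
(* The darts of face i and colour b whose edge is shared with a neighbour. *)
pose Y := [set d | (i.+1 < n) && (d == crossing i) && (slope i == b)]
  :|: [set d | (0 < i) && (d == rev (crossing i.-1)) && (slope i.-1 != b)].
have subXY : X \subset Y.
  apply/subsetP => d; move/existsP: none => none dX.
  have orN : ~~ outer (rev d) by apply/negP => o; apply: none; exists d; rewrite dX.
  move: dX; rewrite in_face_class => /andP[dd /eqP cd].
  have id := inner_face id0 dd; have /andP[d_dart _] := id.
  have ird : inner (rev d) by rewrite /inner dart_rev d_dart.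
  have pd : pos d = i by rewrite -pd0; apply/eqP; rewrite pos_eq // -mem_face.
  have [j j1n dj] := shared_dart G_2conn G_outer s_chain id ird.
  have [_ _ p1 p2] := crossing_facts j1n; rewrite !inE.
  case: dj => e; rewrite e ?p1 ?p2 in pd.
    by rewrite -pd j1n e eqxx -cd e eqxx.
  rewrite -pd /= e eqxx /= -cd e tail_color_rev_crossing //.
  by case: (slope j); rewrite orbT.
have Y1 (P : bool) (e : D) (Q : bool) : #|[set d | P && (d == e) && Q]| = P && Q.
  case: P; case: Q => /=.
  - by rewrite -[RHS](cards1 e); apply: eq_card => d; rewrite !inE andbT.
  - by apply: eq_card0 => d; rewrite !inE andbF.
  - by apply: eq_card0 => d; rewrite !inE.
  - by apply: eq_card0 => d; rewrite !inE.
have := leq_trans (subset_leq_card subXY) (leq_card_setU _ _).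
rewrite !Y1; set P1 := _ && _; set P2 := _ && _ => leX.
have [/andP[i1n /eqP e1] /andP[i0 e2] X2'] : [/\ P1, P2 & #|X| = 2].
  case: P1 leX; case: P2 => /= leX; try by have := leq_trans X2 leX.
  by split=> //; apply/eqP; rewrite eqn_leq X2 andbT; exact: leX.
move: av; rewrite /available /turn fourE X2' i0 i1n e1 !eqxx.
by rewrite e2.
Qed.

(** A free edge of the colour of both shared edges makes three edges of one colour,
    too many for a 4-cycle. *)
Lemma free_available d : inner d -> outer (rev d) -> avail (pos d) (tail_color d).
Proof.
move=> id od; rewrite /available; apply/negP => /and5P[p0 p1n tn f /eqP cd].
have /andP[dd _] := id.
set i := pos d in p0 p1n tn f cd.
pose X := face_class d (tail_color d).
have cardX : #|X| = 2.
  move: f; rewrite /square nth_pos // card_boundary // (card_face_class (tail_color d) dd).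
  by rewrite -[4]/(2.*2) -!muln2 eqn_pmul2r // => /eqP.
have [i1 ir1 p1 pr1] := crossing_facts p1n.
have p2n : i.-1.+1 < n by rewrite prednK // ltnW.
have [i2 ir2 p2 pr2] := crossing_facts p2n; rewrite prednK // in pr2.
have inX a : inner a -> pos a = i -> tail_color a = tail_color d -> a \in X.
  move=> ia pa ca; rewrite in_face_class ca eqxx andbT mem_face //; last by case/andP: ia.
  by rewrite -(pos_eq G_2conn s_chain) // pa.
have a1 : crossing i \in X by apply: inX.
have a2 : rev (crossing i.-1) \in X.
  apply: inX => //; rewrite tail_color_rev_crossing // cd.
  by move: tn; rewrite /turn; case: (slope i); case: (slope i.-1).
have a3 : d \in X by apply: inX.
have n12 : crossing i != rev (crossing i.-1).
  apply/eqP => e; have /eqP := pr1.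
  by rewrite e rev_dartK p2 ltn_eqF // ltnS leq_pred.
have n13 : d != crossing i.
  by apply: contraTneq od => ->; case/andP: ir1.
have n23 : d != rev (crossing i.-1).
  by apply: contraTneq od => ->; rewrite rev_dartK; case/andP: i2.
have sub : {subset [:: d; crossing i; rev (crossing i.-1)] <= X}.
  by move=> a; rewrite !in_cons in_nil orbF => /or3P[]/eqP->.
have uniq3 : uniq [:: d; crossing i; rev (crossing i.-1)].
  by rewrite /= !inE negb_or n13 n23 n12.
have : size [:: d; crossing i; rev (crossing i.-1)] <= #|X|.
  by rewrite cardE; apply: (uniq_leq_size uniq3) => a /sub; rewrite mem_enum.
by rewrite cardX.
Qed.

(** Together with [dart_of_event]: the edges of G are the usable events of the whole
    chain, so that bounds for words become bounds for edge sets. *)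
Lemma event_of_dart d : is_dart d ->
  exists2 ev, usable 0 ev & forall w, matched c (letter w) d = holds w ev.
Proof.
have free d' : inner d' -> outer (rev d') ->
    exists2 ev, usable 0 ev & forall w, matched c (letter w) d' = holds w ev.
  move=> id od; exists (Free (pos d') (tail_color d')) => /=.
    by rewrite pos_lt // free_available // orbT.
  by case/andP: id => _ /negPf id w; rewrite /matched id od andbT.
move=> dd; case od: (outer d).
  have id : inner (rev d) by rewrite /inner dart_rev dd outer_rev.
  have [|ev uev hev] := free _ id; first by rewrite rev_dartK.
  by exists ev => // w; rewrite -hev matched_rev.
have id : inner d by rewrite /inner dd od.
case ord: (outer (rev d)); first exact: free.
have ird : inner (rev d) by rewrite /inner dart_rev dd ord.
have [i i1n di] := shared_dart G_2conn G_outer s_chain id ird.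
have [/andP[ddi /negPf o1] /andP[_ /negPf o2] p1 p2] := crossing_facts i1n.
exists (Shared i) => //= w.
have -> : matched c (letter w) d = matched c (letter w) (crossing i).
  by case: di => ->; rewrite ?matched_rev.
rewrite /matched o1 o2 /= /letter p1 p2 tail_color_rev // -/(slope i).
by case: (w i.+1); case: (slope i).
Qed.

Lemma dart_of_event ev : usable 0 ev ->
  exists2 d, is_dart d & forall w, matched c (letter w) d = holds w ev.
Proof.
case: ev => [i b|i] /=.
  case/andP=> ilt av; have {}av : avail i b.
    by case/orP: av => // /eqP->.
  have [d [/andP[dd /negPf od] pd cd ord]] := free_dart ilt av.
  by exists d => // w; rewrite /matched od ord andbT /letter pd cd.
move=> i1n; have [/andP[dd /negPf o1] /andP[_ /negPf o2] p1 p2] := crossing_facts i1n.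
exists (crossing i) => // w; rewrite /matched o1 o2 /= /letter p1 p2 tail_color_rev //.
by rewrite -/(slope i); case: (w i.+1); case: (slope i).
Qed.

Definition word_matching w : {set {set G}} := matching_of c (letter w).

Lemma word_matching_perfect w : valid n slope 0 w -> perfect_matching (word_matching w).
Proof.
move=> /consistent_letter cons; apply: matching_of_perfect => //; exact: letter_facewise.
Qed.

Lemma perfect_matching_word N : perfect_matching N ->
  exists2 w, valid n slope 0 w & N = word_matching w.
Proof.
move=> /(perfect_matching_of_facewise G_2conn G_outer c_proper)[y [yf yc ->]].
pose w i := if [pick d | inner d && (pos d == i)] is Some d then y d else false.
have yw d : inner d -> letter w d = y d.
  move=> id; rewrite /letter /w; case: pickP => [d' /andP[id' /eqP e]|/(_ d)]; last first.
    by rewrite id eqxx.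
  have /eqP := e; rewrite (pos_eq G_2conn s_chain) // -mem_face; last 2 first.
  - by case/andP: id.
  - by case/andP: id'.
  by apply: face_invariant => //; case/andP: id.
have yw' d : is_dart d ->
    outer d || (letter w d == tail_color d) = outer d || (y d == tail_color d).
  by move=> dd; case od: (outer d) => //=; rewrite yw // /inner dd od.
exists w.
  apply/consistent_letter => d dd od ord; have := yc d dd od ord.
  by rewrite !yw // /inner ?dart_rev ?dd.
apply/setP => e; apply/imsetP/imsetP => -[d /andP[dd md] ->]; exists d => //; apply/andP.
  by rewrite /matched !yw' ?dart_rev.
by rewrite /matched -!yw' ?dart_rev.
Qed.

Lemma word_edge w d : is_dart d -> (edge d \in word_matching w) = matched c (letter w) d.
Proof. exact: mem_matching_of. Qed.

(** At every face there is a free edge of at least one colour, and its presence in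
    the matching determines the letter. *)
Lemma word_matching_inj w w' i : i < n -> word_matching w = word_matching w' -> w i = w' i.
Proof.
move=> ilt e; have [b av] : exists b, avail i b.
  have [av|nav] := boolP (avail i true); first by exists true.
  exists false; apply/negP => /and5P[_ _ _ _ /eqP e0].
  by move: nav; rewrite /available -e0 !andbF.
have [d [/andP[dd /negPf od] pd cd ord]] := free_dart ilt av.
have := word_edge w dd; rewrite e word_edge //.
rewrite /matched od ord !andbT /= /letter pd cd.
by case: (w i); case: (w' i); case: (b).
Qed.

Lemma eq_word_matching w w' :
  (forall i, i < n -> w i = w' i) -> word_matching w = word_matching w'.
Proof.
move=> ww'; have same d : is_dart d ->
    outer d || (letter w d == tail_color d) = outer d || (letter w' d == tail_color d).
  move=> dd; case od: (outer d) => //=.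
  by rewrite /letter ww' // pos_lt // /inner dd od.
apply/setP => e; apply/imsetP/imsetP => -[d /andP[dd md] ->]; exists d => //; apply/andP.
  by rewrite /matched -!same ?dart_rev.
by rewrite /matched !same ?dart_rev.
Qed.

End Words.

(** * Kinks and segments *)

Section CycleMatchings.
Variable G : plane_graph.
Hypothesis G_2conn : two_connected G.
Variable c : G -> bool.
Hypothesis c_proper : forall u v : G, adj u v -> c u != c v.
Local Notation D := (G * G)%type.
Local Notation edge := (@edge_of G).
Local Notation phi := (face_step (@Defs.rot G)).
Local Notation face := (face_of (@Defs.rot G)).
Local Notation bd d := (boundary (face d)).
Local Notation tail_color := (@tail_color G c).
Variable d0 : D.
Hypothesis dd0 : is_dart d0.

Lemma edge_tail (d : D) : d.1 \in edge d. Proof. exact: set21. Qed.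
Lemma edge_head (d : D) : d.2 \in edge d. Proof. exact: set22. Qed.

Lemma step_in_face d : d \in face d0 -> phi d \in face d0.
Proof. by rewrite -{2}(step_face dd0); exact: imset_f. Qed.

Lemma boundary_at d e : d \in face d0 -> e \in bd d0 -> d.2 \in e ->
  e = edge d \/ e = edge (phi d).
Proof.
move=> ddf /imsetP[a adf ->]; have da := face_dart dd0 adf; have dd := face_dart dd0 ddf.
have same b : b \in face d0 -> b.1 = d.2 -> b = phi d.
  move=> bf bd; have db := face_dart dd0 bf.
  apply: (face_tail_inj G_2conn); rewrite ?dart_step //.
  by rewrite mem_face ?dart_step // face_step_eq // !(face_eq dd0).
rewrite !inE => /orP[]/eqP ad; first by right; rewrite (same a).
left; suff -> : a = d by [].
by apply: step_inj => //; apply: same; [exact: step_in_face | ].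
Qed.

Lemma boundary_head v : v \in cover (bd d0) -> exists2 d, d \in face d0 & v = d.2.
Proof.
case/bigcupP=> _ /imsetP[a af ->]; rewrite !inE => /orP[]/eqP ->; last by exists a.
by rewrite -(step_face dd0) in af; case/imsetP: af => d df ->; exists d.
Qed.

Lemma edge_step_neq d : d \in face d0 -> edge (phi d) != edge d.
Proof.
move=> df; apply: contraTneq (dart_neq (face_dart dd0 df)) => e.
have := edge_inj_face G_2conn dd0 (step_in_face df) df e => {}e.
by rewrite negbK -{1}e.
Qed.

(** A perfect matching of a cycle contains exactly one of two consecutive edges, so it
    is constant relative to the colours. *)
Lemma cycle_matching_class M d1 d2 : perfect_matching_of (cover (bd d0)) (bd d0) M ->
  d1 \in face d0 -> d2 \in face d0 -> edge d1 \in M -> edge d2 \in M ->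
  tail_color d1 = tail_color d2.
Proof.
case/andP=> /subsetP subM /forall_inP M1 d1f d2f m1 m2.
have alt d : d \in face d0 -> (edge (phi d) \in M) = ~~ (edge d \in M).
  move=> df; have covd : d.2 \in cover (bd d0).
    by apply/bigcupP; exists (edge d); [exact: imset_f | rewrite !inE eqxx orbT].
  have /cards1P[e0 E] := M1 _ covd.
  have at_d e : e \in M -> d.2 \in e -> e = e0.
    by move=> eM de; apply/set1P; rewrite -E inE eM.
  have : e0 \in [set e in M | d.2 \in e] by rewrite E set11.
  rewrite inE => /andP[e0M de0].
  have h1 : d.2 \in edge (phi d) := edge_tail (phi d).
  have h2 : d.2 \in edge d := edge_head d.
  case: (boundary_at df (subM _ e0M) de0) => e0E; rewrite e0E in e0M.
    rewrite e0M; apply/negP => pM; have := at_d _ pM h1; rewrite e0E => /eqP.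
    by rewrite (negPf (edge_step_neq df)).
  rewrite e0M; apply/esym/negP => pM; have := at_d _ pM h2; rewrite e0E => /esym/eqP.
  by rewrite (negPf (edge_step_neq df)).
pose P d := (d \in face d0) && ((edge d \in M) (+) tail_color d).
have Pphi d : is_dart d -> P (phi d) = P d.
  move=> dd; rewrite /P mem_face ?dart_step // face_step_eq // -mem_face //.
  case df: (d \in face d0) => //=; rewrite alt // tail_color_step //.
  by case: (_ \in M); case: (tail_color d).
have := face_invariant Pphi dd0 d1f; rewrite -(face_invariant Pphi dd0 d2f).
by rewrite /P d1f d2f m1 m2 /=; case: (tail_color d1); case: (tail_color d2).
Qed.

Lemma class_cycle_matching b :
  perfect_matching_of (cover (bd d0)) (bd d0) (edge @: face_class c d0 b).
Proof.
apply/andP; split.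
  by apply: imsetS; apply/subsetP => a; rewrite in_face_class => /andP[].
apply/forall_inP => _ /boundary_head[d df ->]; have dd := face_dart dd0 df.
have [x [xf xv xb]] : exists x, [/\ x \in face d0, d.2 \in edge x & tail_color x = b].
  have [cd|cd] := eqVneq (tail_color d) b; first by exists d; rewrite edge_head.
  exists (phi d).
  rewrite step_in_face // (edge_tail (phi d)) tail_color_step //; split=> //.
  by move: cd; case: (tail_color d); case: (b).
apply/cards1P; exists (edge x); apply/setP => e; rewrite in_set in_set1.
apply/andP/eqP => [[/imsetP[a + ->] da]|->]; last first.
  by split=> //; apply: imset_f; rewrite in_face_class xf xb eqxx.
rewrite in_face_class => /andP[af /eqP ab].
suff -> : a = x by [].
have inj := edge_inj_face G_2conn dd0; have pf := step_in_face df.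
have abd : edge a \in bd d0 by exact: imset_f.
have xbd : edge x \in bd d0 by exact: imset_f.
have ad : a = d \/ a = phi d.
  by case: (boundary_at df abd da) => e'; [left | right]; apply: inj.
have xd : x = d \/ x = phi d.
  by case: (boundary_at df xbd xv) => e'; [left | right]; apply: inj.
move: xb; rewrite -ab; case: ad => ->; case: xd => -> //; rewrite tail_color_step //;
  by case: (tail_color d).
Qed.

End CycleMatchings.

Section Segments.
Variable G : plane_graph.
Hypothesis G_2conn : two_connected G.
Hypothesis G_outer : outerplane G.
Variable c : G -> bool.
Hypothesis c_proper : forall u v : G, adj u v -> c u != c v.
Local Notation D := (G * G)%type.
Local Notation rev := (@rev_dart G).
Local Notation edge := (@edge_of G).
Local Notation face := (face_of (@Defs.rot G)).
Local Notation bd d := (boundary (face d)).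
Variable s : seq {set {set G}}.
Hypothesis s_chain : chain_labelling s.
Local Notation n := (size s).
Local Notation pos := (@pos G s).
Local Notation crossing := (@crossing G s).
Local Notation tail_color := (@tail_color G c).
Local Notation slope := (@slope G c s).
Local Notation square := (@square G s).

Let facts i (i1n : i.+1 < n) := crossing_facts G_2conn s_chain i1n.

Lemma crossing_edge_in k i : k.+1 < n -> i < n ->
  (edge (crossing k) \in nth set0 s i) = (k == i) || (k.+1 == i).
Proof.
move=> k1n ilt; have [i1 i2 p1 p2] := facts k1n; have /andP[dd _] := i1.
by rewrite (edge_in_cycle G_2conn s_chain) // i1 i2 p1 p2.
Qed.

Lemma shared_edgeP a e :
  reflect (exists k, [/\ a <= k, k.+1 < n & e = edge (crossing k)])
          (shared_edge (drop a s) e).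
Proof.
have memd C : C \in drop a s -> exists p, [/\ a <= p, p < n & nth set0 s p = C].
  case/(nthP set0) => j; rewrite size_drop nth_drop => jlt <-.
  by exists (a + j); split=> //; [exact: leq_addr | rewrite -ltn_subRL].
apply: (iffP hasP) => [[C1 /memd[p [ap pn <-]] /hasP[C2 /memd[q [aq qn <-]]]]|].
  case/andP=> Cneq; rewrite inE => /andP[ep eq].
  have pq : p != q by apply: contraNneq Cneq => ->.
  have [d0 id0 pd0] := pos_surj G_2conn s_chain pn.
  have [d dd e_d] : exists2 d, is_dart d & e = edge d.
    move: ep; rewrite -pd0 (nth_pos G_2conn s_chain) // => /imsetP[d df ->].
    by exists d => //; apply: face_dart df; case/andP: id0.
  move: ep eq; rewrite e_d !(edge_in_cycle G_2conn s_chain) //.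
  move=> dp dq; have [id ird ad ard] :
      [/\ inner d, inner (rev d), a <= pos d & a <= pos (rev d)].
    case/orP: dp => /andP[i1 /eqP dp]; case/orP: dq => /andP[i2 /eqP dq].
    - by rewrite -dp -dq eqxx in pq.
    - by split=> //; rewrite ?dp ?dq.
    - by split=> //; rewrite ?dp ?dq.
    - by rewrite -dp -dq eqxx in pq.
  have [k k1n dk] := shared_dart G_2conn G_outer s_chain id ird.
  have [_ _ p1 p2] := facts k1n; exists k; split=> //.
    by case: dk => dk; move: ad ard; rewrite dk ?rev_dartK p1.
  by case: dk => ->; rewrite ?edge_rev.
case=> k [ak k1n ->]; have kn := ltnW k1n.
have in_drop p : a <= p -> p < n -> nth set0 s p \in drop a s.
  move=> ap pn; rewrite -(subnKC ap) -nth_drop mem_nth // size_drop.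
  by rewrite ltn_sub2r // (leq_ltn_trans ap).
exists (nth set0 s k); first exact: in_drop.
apply/hasP; exists (nth set0 s k.+1); first by apply: in_drop => //; exact: leqW.
rewrite inE !crossing_edge_in // !eqxx orbT !andbT nth_uniq ?(chain_uniq s_chain) //.
by rewrite ltn_eqF.
Qed.

(** The two shared edges of face i have the colours [~~ slope i.-1] and [slope i]. *)
Lemma kinkE a i : a <= i -> i < n ->
  kink (drop a s) (nth set0 s i) = [&& a < i, i.+1 < n & turn slope i].
Proof.
move=> ai ilt; have [d0 id0 pd0] := pos_surj G_2conn s_chain ilt.
have /andP[dd0 _] := id0.
have nthE : nth set0 s i = bd d0 by rewrite -pd0 nth_pos.
have in_face d : inner d -> pos d = i -> d \in face d0.
  move=> id pd; rewrite mem_face //; last by case/andP: id.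
  by rewrite -(pos_eq G_2conn s_chain) // pd pd0.
apply/idP/and3P.
  case/existsP=> e1 /andP[e1i /existsP[e2 /andP[e2i]]].
  case/and4P=> e12 /shared_edgeP[k1 [ak1 k1n e1E]] /shared_edgeP[k2 [ak2 k2n e2E]].
  case/existsP=> M /and3P[PM m1 m2].
  have {e12} k12 : k1 != k2.
    by apply: contraNneq e12 => k12; rewrite e1E e2E k12.
  have : (k1 == i) || (k1.+1 == i) by rewrite -crossing_edge_in // -e1E.
  have : (k2 == i) || (k2.+1 == i) by rewrite -crossing_edge_in // -e2E.
  have main k k' : a <= k -> k.+1 < n -> k'.+1 < n -> k.+1 = i -> k' = i ->
      edge (crossing k) \in M -> edge (crossing k') \in M ->
      [/\ a < i, i.+1 < n & turn slope i].
    move=> ak kn k'n ki k'i mk mk'; split; [by rewrite -ki | by rewrite -k'i | ].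
    have [i1 ir1 p1 pr1] := facts kn; have [i2 ir2 p2 pr2] := facts k'n.
    rewrite nthE in PM; rewrite -edge_rev in mk.
    have f1 : rev (crossing k) \in face d0 by apply: in_face; rewrite // pr1.
    have f2 : crossing k' \in face d0 by apply: in_face; rewrite // p2.
    have := cycle_matching_class G_2conn c_proper dd0 PM f1 f2 mk mk'.
    rewrite (tail_color_rev_crossing G_2conn c_proper s_chain) // /turn -ki k'i /= => e.
    by rewrite -[X in _ != X]/(tail_color (crossing k.+1)) ki -e; case: (slope k).
  rewrite e1E e2E in m1 m2.
  case/orP=> /eqP k2i /orP[]/eqP k1i.
  - by rewrite k1i k2i eqxx in k12.
  - exact: (main k1 k2).
  - exact: (main k2 k1).
  - by case/eqP: k12; apply: succn_inj; rewrite k1i k2i.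
case=> ai' i1n ti; have p_lt : i.-1.+1 < n by rewrite prednK // (leq_ltn_trans _ ai').
have i0 : 0 < i by exact: leq_ltn_trans ai'.
have [i1 ir1 p1 pr1] := facts p_lt; have [i2 ir2 p2 pr2] := facts i1n.
rewrite prednK // in pr1.
have f1 : rev (crossing i.-1) \in face d0 by exact: in_face.
have f2 : crossing i \in face d0 by exact: in_face.
apply/existsP; exists (edge (crossing i.-1)); apply/andP; split.
  by rewrite nthE -edge_rev; exact: imset_f.
apply/existsP; exists (edge (crossing i)); apply/andP; split.
  by rewrite nthE; exact: imset_f.
apply/and4P; split.
- apply/eqP => /(crossing_inj G_2conn s_chain p_lt i1n) /eqP; by rewrite ltn_eqF // prednK.
- by apply/shared_edgeP; exists i.-1; split=> //; rewrite -ltnS prednK.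
- by apply/shared_edgeP; exists i.
apply/existsP; exists [set edge d | d in face_class c d0 (slope i)].
rewrite nthE class_cycle_matching // -(edge_rev (crossing i.-1)) !imset_f //.
  by rewrite in_face_class f2 eqxx.
rewrite in_face_class f1 (tail_color_rev_crossing G_2conn c_proper s_chain) //=.
by move: ti; rewrite /turn; case: (slope i); case: (slope i.-1).
Qed.

Lemma first_segment_run a : a < n ->
  first_run n slope square a (a + first_segment_size (drop a s)).
Proof.
move=> an; rewrite /first_segment_size; set C := drop a s.
have sizeC : size C = n - a by rewrite size_drop.
have nthC j : nth set0 C j = nth set0 s (a + j) by rewrite nth_drop.
set i := find (kink C) C.
have before x : x < a + i -> a < x -> x.+1 < n -> ~~ turn slope x.
  move=> xi ax x1n; have := before_find set0 (a := kink C) (s := C) (i := x - a).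
  rewrite nthC subnKC ?(ltnW ax) // kinkE ?(ltnW ax) ?(ltnW x1n) // ax x1n /= -/i.
  by move=> ->; rewrite // ltn_subLR // ltnW.
have [Ci|iC] := leqP (size C) i.
  rewrite sizeC subnKC ?(ltnW an) //; apply: NoTurn => // x ax x1n.
  by apply: before => //; lia.
have ain : a + i < n by lia.
have kinki : kink C (nth set0 C i) by apply: nth_find; rewrite has_find.
rewrite nthC kinkE ?leq_addr // in kinki; case/and3P: kinki => a_i i1n ti.
rewrite nthC; case: ifP => [fi|/negbT nfi].
  by rewrite addnS; apply: SquareTurn => // x /andP[ax xi]; apply: before => //; lia.
set j := find (kink C) (drop i.+1 C).
have after x : a + i < x -> x < a + (i.+1 + j) -> x.+1 < n -> ~~ turn slope x.
  move=> ix xj x1n; have := before_find set0 (a := kink C) (s := drop i.+1 C)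
                              (i := x - a - i.+1).
  rewrite nth_drop nthC (_ : a + _ = x); last lia.
  rewrite kinkE; [|lia|lia]; rewrite x1n (_ : a < x) /=; last lia.
  by move=> ->; rewrite // -/j; lia.
have [Cj|jC] := leqP (size C) (i.+1 + j).
  rewrite sizeC subnKC ?(ltnW an) //; apply: (OneTurn (i := a + i)) => // x ax x1n xi.
  have [xi'|ix] := ltnP x (a + i); first exact: before.
  by apply: after; lia.
have kinkj : kink C (nth set0 (drop i.+1 C) j).
  by apply: nth_find; rewrite has_find size_drop; lia.
rewrite nth_drop nthC kinkE in kinkj; [|lia|lia].
case/and3P: kinkj => a_j j1n tj; rewrite addnS.
apply: (TwoTurns (i := a + i)) => //; first by lia.
move=> x /andP[ax xj] xi; have [xi'|ix] := ltnP x (a + i).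
  by apply: before; lia.
by apply: after; lia.
Qed.

Lemma segments_runs fuel a : a <= n -> n - a <= fuel ->
  runs n slope square a (size (segments_rec fuel (drop a s))).
Proof.
elim: fuel a => [|fuel IH] a an afuel.
  have -> : a = n by lia.
  exact: RunsNil.
have [na|an'] := leqP n a.
  have -> : a = n by lia.
  by rewrite drop_size; exact: RunsNil.
have run := first_segment_run an'.
have [m_le m_gt] : a + first_segment_size (drop a s) <= n /\
    a < a + first_segment_size (drop a s).
  by move: run; set b := a + _; case=> *; lia.
rewrite [segments_rec _ _]/=; case E: (drop a s) => [|C l].
  by have := congr1 size E; rewrite size_drop /=; lia.
rewrite -E /=; apply: RunsCons run _; rewrite drop_drop addnC.
by apply: IH => //; lia.
Qed.

End Segments.

(** * Anti-forcing numbers *)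

Section AntiForcing.
Variable G : sgraph.
Implicit Types M N S : {set {set G}}.

Lemma perfect_matching_avoiding S N :
  perfect_matching_of [set: G] (edges G :\: S) N = perfect_matching N && [disjoint N & S].
Proof.
rewrite /perfect_matching /perfect_matching_of subsetD -!andbA.
by congr (_ && _); rewrite andbC.
Qed.

Lemma anti_forcingP M S : perfect_matching M ->
  reflect [/\ S \subset edges G, [disjoint M & S]
    & forall N, perfect_matching N -> [disjoint N & S] -> N = M]
  (anti_forcing_set M S).
Proof.
move=> PM; rewrite /anti_forcing_set subsetD disjoint_sym.
apply: (iffP andP) => [[/andP[SG MS] /eqP/setP U]|[SG MS U]]; split=> //.
- by move=> N PN NS; have := U N; rewrite !inE perfect_matching_avoiding PN NS => /esym/eqP.
- by rewrite SG.
apply/eqP/setP => N; rewrite !inE perfect_matching_avoiding.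
by apply/andP/eqP => [[PN NS]|->]; [exact: U | ].
Qed.

(** A perfect matching contained in M has an edge of M at each vertex, hence is M. *)
Lemma anti_forcing_rest M : perfect_matching M -> anti_forcing_set M (edges G :\: M).
Proof.
move=> PM; apply/anti_forcingP => //; have /perfect_matchingP[MG M1] := PM.
split; [exact: subsetDl | by rewrite disjoints_subset setCD subsetU // subxx orbT | ].
move=> N /perfect_matchingP[NG N1]; rewrite disjoints_subset setCD => NsM.
have {}NsM : N \subset M.
  apply/subsetP => e eN; have := subsetP NsM e eN.
  by rewrite !inE (subsetP NG).
apply/eqP; rewrite eqEsubset NsM; apply/subsetP => e eM.
have /mem_edges[d dd e_d] := subsetP MG e eM; apply/negPn/negP => eN.
have : \sum_(d' | is_dart d' && (d'.1 == d.1)) (edge_of d' \in N : nat)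
     < \sum_(d' | is_dart d' && (d'.1 == d.1)) (edge_of d' \in M : nat).
  rewrite (bigD1 d) ?dd ?eqxx //= [X in _ < X](bigD1 d) ?dd ?eqxx //= -e_d eM (negPf eN).
  rewrite ltnS; apply: leq_sum => d' _; case d'N: (_ \in N) => //.
  by rewrite (subsetP NsM).
by rewrite N1 M1.
Qed.

Lemma af_le M S : perfect_matching M -> anti_forcing_set M S -> af G <= #|S|.
Proof.
move=> PM MS; rewrite /af; case: pickP => [M0 PM0|/(_ M)]; last by rewrite PM.
case: arg_minnP => // M1 PM1 /(_ M PM) /leq_trans; apply; rewrite /af_matching.
by case: arg_minnP => [|S1 _]; [exact: anti_forcing_rest | apply].
Qed.

Lemma af_ge t M0 : perfect_matching M0 ->
  (forall M S, perfect_matching M -> anti_forcing_set M S -> t <= #|S|) -> t <= af G.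
Proof.
move=> PM0 lb; rewrite /af; case: pickP => [M1 PM1|/(_ M0)]; last by rewrite PM0.
case: arg_minnP => // M PM _; rewrite /af_matching.
by case: arg_minnP => [|S MS _]; [exact: anti_forcing_rest | exact: lb MS].
Qed.

End AntiForcing.

Theorem theorem4p11 (G : plane_graph) (hG : even_polygonal_chain G)
    (s : seq {set {set G}}) (hs : chain_labelling s) :
  af G = size (segment_decomposition s).
Proof.
have [G_2conn [c c_proper] G_outer _] := hG.
pose k := slope c s; pose M w := word_matching c s w.
have M_perfect w : valid (size s) k 0 w -> perfect_matching (M w).
  exact: word_matching_perfect.
have runs0 : runs (size s) k (square s) 0 (size (segment_decomposition s)).
  have := segments_runs G_2conn G_outer c_proper hs (leq0n (size s)) (leqnn _).
  by rewrite subn0 drop0.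
set t := size (segment_decomposition s) in runs0 *.
have s_gt0 : 0 < size s.
  have o := outer_dart_adj G; have o_outer : outer (outer_dart G) := face_id _.
  apply: leq_ltn_trans (leq0n _) (pos_lt G_2conn hs (d := rev_dart (outer_dart G)) _).
  by rewrite /inner dart_rev outer_rev // andbT.
have [m [evs [evs_size m_valid evs_ok m_forced]]] := upper_bound s_gt0 runs0.
apply/eqP; rewrite eqn_leq; apply/andP; split.
  (* The edges that correspond to the forbidden events. *)
  have [S [S_size SG S_evs]] : exists S : {set {set G}}, [/\ #|S| <= size evs,
      S \subset edges G & forall w,
      [disjoint M w & S] = all (fun ev => ~~ holds k w ev) evs].
    elim: evs evs_ok {evs_size m_forced} => [_|ev evs IH /andP[/andP[uev _] ok]].
      by exists set0; rewrite cards0 sub0set; split=> // w; rewrite -setI_eq0 setI0 eqxx.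
    have [S [S_size SG S_evs]] := IH ok.
    have [d dd dE] := dart_of_event G_2conn G_outer c_proper hs uev.
    exists (edge_of d |: S); split.
    - by rewrite cardsU1 /= -add1n leq_add // leq_b1.
    - by rewrite subUset sub1set edge_in.
    - move=> w; rewrite disjoint_sym -setI_eq0 setIUl setU_eq0 !setI_eq0 disjoints1.
      by rewrite disjoint_sym S_evs word_edge // dE.
  rewrite -evs_size; apply: leq_trans S_size; apply: (@af_le _ (M m)).
    exact: M_perfect.
  apply/anti_forcingP; first exact: M_perfect.
  split=> //; first by rewrite S_evs; apply: sub_all evs_ok => ev /andP[].
  move=> N /(perfect_matching_word G_2conn G_outer c_proper hs)[w wv ->].
  rewrite S_evs => w_evs.
  apply: eq_word_matching => // i i_lt; exact: m_forced.
apply: (@af_ge _ _ (M m)); first exact: M_perfect.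
move=> N S PN NS; have [w wv Nw] := perfect_matching_word G_2conn G_outer c_proper hs PN.
have {}Nw : N = M w := Nw.
have [W [W_alt W_comp]] := lower_bound runs0 wv.
have /anti_forcingP-/(_ PN)[SG N_S N_unique] := NS.
(* Each alternative contains an edge of S, and compatibility makes these edges
   distinct. *)
pose f (p : 'I_t) := odflt set0 [pick e | (e \in S) && (e \in M (W p))].
have fP p : f p \in S :&: M (W p).
  rewrite /f; case: pickP => [e|none]; first by rewrite inE.
  have [Wv [i ii neq]] := W_alt p (ltn_ord p).
  case/eqP: neq; apply: (word_matching_inj G_2conn G_outer c_proper hs).
    by case/andP: ii.
  rewrite -/(M (W p)) -/(M w) -Nw; apply: N_unique; first exact: M_perfect.
  rewrite disjoint_sym disjoints_subset; apply/subsetP => e eS; rewrite inE.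
  by have := none e; rewrite eS /= => ->.
have f_neq (p q : 'I_t) : p < q -> f p != f q.
  move=> pq; apply/eqP => e; have := fP p; have := fP q; rewrite !inE -e.
  case/andP=> fS fq /andP[_ fp].
  have /mem_edges[d dd f_d] := subsetP SG _ fS.
  have [ev uev evE] := event_of_dart G_2conn G_outer c_proper hs dd.
  have pqt : p < q < t by rewrite pq /=.
  have mem u : (f p \in M u) = holds k u ev by rewrite f_d word_edge.
  have := W_comp p q pqt ev uev; rewrite -!mem fp fq -Nw.
  by move=> /(_ (negbT (disjointFl N_S fS))).
have f_inj : injective f.
  move=> p q e; apply/val_inj; case: (ltngtP p q) => // pq.
    by have := f_neq p q pq; rewrite e eqxx.
  by have := f_neq q p pq; rewrite e eqxx.
rewrite -(card_ord t) -(card_imset predT f_inj); apply/subset_leq_card/subsetP.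
by move=> _ /imsetP[p _ ->]; have := fP p; rewrite inE => /andP[].
Qed.
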